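(* For every integer $d\geq 2$, \[ SA_d \geq \frac{1}{\sqrt{d-1}} . \]
   Context: $\mathbb{D}^d=\{z=(z_1,\dots,z_d)\in\mathbb{C}^d: |z_1|,\dots,|z_d|<1\}$ is the open unit polydisk. The Schur class $\mathcal{S}_d$ is the set of all analytic $f:\mathbb{D}^d\to\overline{\mathbb{D}}$, where $\overline{\mathbb D}$ is the closed unit disk. The (Schur-)Agler class $\mathcal{A}_d$ is the set of all $f\in\mathcal{S}_d$ such that $\|f(T_1,\dots,T_d)\|\leq 1$ (operator norm) for all $d$-tuples $T=(T_1,\dots,T_d)$ of pairwise commuting strictly contractive operators ($\|T_j\|<1$) on a common complex Hilbert space; here, if $f(z)=\sum_{\alpha\in\mathbb{N}^d} f_\alpha z^\alpha$, then $f(T)=\sum_\alpha f_\alpha T^\alpha$, with $T^\alpha=T_1^{\alpha_1}\cdots T_d^{\alpha_d}$ and $\mathbb{N}$ including $0$. For $0<r<1$ set $f_r(z)=f(rz)$. The Schur-Agler radius is $SA_d=\sup\{r\in(0,1): f_r\in\mathcal{A}_d \text{ for all } f\in\mathcal{S}_d\}$. *)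

(* Defs.v *)
From HB Require Import structures.
From mathcomp Require Import all_boot all_order all_algebra finmap.
From mathcomp Require Import sesquilinear.
From mathcomp Require Import complex.
From mathcomp Require Import boolp classical_sets functions reals ereal.
From mathcomp Require Import constructive_ereal topology normedtype.
From mathcomp.analysis.showcase Require Import summability.

Set Implicit Arguments.
Unset Strict Implicit.
Unset Printing Implicit Defensive.

Import Order.TTheory GRing.Theory Num.Theory.
Import numFieldNormedType.Exports.

Local Open Scope classical_set_scope.
Local Open Scope ring_scope.

(* Typing [R[i]] as a [numFieldType] gives it its canonical norm and topology. *)
Definition Cplx (R : realType) : numFieldType := R[i].

Definition multi_index (d : nat) := {ffun 'I_d -> nat}.

(* Unconditional summation: convergence of the net of finite partial sums. *)
Definition has_sum (I : choiceType) (K : numFieldType) (V : normedModType K)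
    (u : I -> V) (s : V) : Prop :=
  partial_sum u @ totally --> s.

Section SchurAgler.
Variables (R : realType) (d : nat).
Local Notation C := (Cplx R).

Definition polydisk : set ('I_d -> C) := [set z | forall j, `|z j| < 1].

Definition monomial (z : 'I_d -> C) (a : multi_index d) : C :=
  \prod_(j < d) z j ^+ a j.

Definition has_power_series_at (f : ('I_d -> C) -> C) (w : 'I_d -> C)
    (c : multi_index d -> C) (z : 'I_d -> C) : Prop :=
  has_sum (fun a => c a * monomial (fun j => z j - w j) a) (f z).

(* Functions on the polydisk are represented by total functions, whose values
   outside the polydisk are irrelevant. *)
Definition analytic_on_polydisk (f : ('I_d -> C) -> C) : Prop :=
  forall w, polydisk w ->
    exists (e : C) (c : multi_index d -> C), 0 < e /\
      forall z, (forall j, `|z j - w j| < e) -> has_power_series_at f w c z.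

Definition schur_class : set (('I_d -> C) -> C) :=
  [set f | analytic_on_polydisk f /\ forall z, polydisk z -> `|f z| <= 1].

Definition is_hilbert (H : completeNormedModType C)
    (ip : {dot H for (@Num.conj R[i])}) : Prop :=
  forall x : H, ip x x = `|x| ^+ 2.

(* Extended-real valued, so that [opnorm T < 1] entails boundedness of [T];
   the norm of [H] takes its (real) values in [C], hence the [complex.Re]. *)
Definition opnorm (H : normedModType C) (T : H -> H) : \bar R :=
  ereal_sup [set (complex.Re `|T x|)%:E | x in [set x : H | `|x| <= 1]].

Definition op_monomial (H : normedModType C) (T : 'I_d -> {linear H -> H})
    (a : multi_index d) : H -> H :=
  \big[(fun g h : H -> H => g \o h)/id]_(j < d) iter (a j) (T j).

(* [S = \sum_a c_a T^a], with convergence in operator norm. *)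
Definition is_op_power_series (H : normedModType C) (c : multi_index d -> C)
    (T : 'I_d -> {linear H -> H}) (S : {linear H -> H}) : Prop :=
  opnorm (fun x => partial_sum (fun a => c a *: op_monomial T a x) A - S x)
    @[A --> totally] --> (0 : \bar R)%E.

Definition commuting_strict_contractions (H : normedModType C)
    (T : 'I_d -> {linear H -> H}) : Prop :=
  (forall i j x, T i (T j x) = T j (T i x)) /\
  (forall j, (opnorm (T j) < 1)%E).

Definition agler_class : set (('I_d -> C) -> C) :=
  [set f | schur_class f /\
    exists c : multi_index d -> C,
      (forall z, polydisk z -> has_power_series_at f (fun=> 0) c z) /\
      forall (H : completeNormedModType C) (ip : {dot H for (@Num.conj R[i])}),
        is_hilbert ip ->
        forall T : 'I_d -> {linear H -> H}, commuting_strict_contractions T ->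
        exists S : {linear H -> H},
          is_op_power_series c T S /\ (opnorm S <= 1)%E].

Definition dilate (r : R) (f : ('I_d -> C) -> C) : ('I_d -> C) -> C :=
  fun z => f (fun j => (r%:C)%C * z j).

Definition schur_agler_radius : R :=
  sup [set r : R | 0 < r < 1 /\
                   forall f, schur_class f -> agler_class (dilate r f)].

End SchurAgler.

(* Main.v *)
From HB Require Import structures.
Require Import Defs.
From mathcomp Require Import all_boot all_order all_algebra all_field finmap.
From mathcomp Require Import sesquilinear spectral zify ring lra complex.
From mathcomp Require Import boolp classical_sets functions reals ereal.
From mathcomp Require Import constructive_ereal topology normedtype derive.
From mathcomp.analysis.showcase Require Import summability.

Set Implicit Arguments.
Unset Strict Implicit.
Unset Printing Implicit Defensive.

Import Order.TTheory GRing.Theory Num.Theory.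
Import numFieldNormedType.Exports.

Local Open Scope classical_set_scope.
Local Open Scope ring_scope.
Local Open Scope sesquilinear_scope.

(** Let f be in the Schur class of the polydisk, let T be a commuting tuple of
    contractions on a Hilbert space, and let al = 1 / sqrt (d - 1).  For every
    r < al the claim is that f (r T) is a contraction.  Writing r = rho * al
    with rho < 1, it is enough to bound f (rho * al * T).

    Taylor coefficients ([schur_expansion]).  On a slice u |-> f (u z), with z
    in the closed polydisk, f is a bounded function of one variable which has a
    third order complex Taylor approximation at every point.  Such functions
    obey the maximum principle ([max_principle]): |g|^2 + eps |z|^2 has no local
    maximum, because averages of |g|^2 over small circles through roots of unity
    are at least |g|^2 at the centre up to a cubic error.  The resulting Schwarz
    lemma ([schwarz]), applied to f minus a Taylor polynomial and to averages of
    f over roots of unity, shows that the Taylor series of f at 0 converges to f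
    on the whole polydisk and that its coefficients are at most 1 in modulus.

    From operators to nilpotent matrices ([krylov_bound]).  Fix x and put, on
    polynomials p in d variables, the seminorm whose square is the sum over k < N
    of |p_k (al T) x|^2, where p_k is the part of p of degree at most k.  The
    multiplication by a variable, where exponents reaching N are dropped, has
    norm at most al for it, and these shifts are commuting nilpotent matrices.
    A bound on f at these matrices, applied to the polynomial 1, bounds the
    Cesaro means of the squared norms of the partial sums of f (r T) x, hence
    f (r T) x itself ([cesaro_limit]).

    The matrix inequality ([matrix_von_neumann]).  Let A be a commuting
    nilpotent tuple with |v A_j|^2 <= al^2 |v|^2 in the seminorm of a positive
    form G.  Replacing G by G - A_j G A_j^* successively for all j but two
    keeps the form positive, and makes the two remaining matrices contractive,
    as long as at most d - 1 of the operations G |-> G - A_j G A_j^* are made,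
    since each of them costs at most al^2 G ([brehmer_bounds]).  This is where
    d - 1, rather than d, comes from.  Each of these variables can then be
    replaced by a scalar of modulus one: the orbit (v A_j^k)_k embeds G
    isometrically in the Hardy space of the new form, A_j becoming a backward
    shift ([peel]).  For the last two matrices A_1, A_2 the same embedding along
    B = A_1 A_2 turns them into multiplications by (p2 + z p1) U^* and
    U (p1 + z p2), with U unitary and p1 + p2 = 1 complementary projections, two
    commuting unitaries with product z ([ando_bound]; this is the model of
    Berger, Coburn and Lebow behind the theorem of Ando).  Diagonalizing them
    leaves the values of f on the torus, which are at most 1.

    All Hardy space norms are computed by the Parseval identity on a finite
    group of roots of unity, so that no integral is needed. *)

(** * Roots of unity and positive forms *)

Lemma closed_prim_root_exists (C : numClosedFieldType) n :
  (0 < n)%N -> exists w : C, n.-primitive_root w.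
Proof.
move=> n_gt0; pose p : {poly C} := 'X^n - 1.
have [r Dp] := closed_field_poly_normal p.
rewrite (monicP _) ?monicXnsubC // scale1r in Dp.
have rn1 : all n.-unity_root r by apply/allP=> z; rewrite -root_prod_XsubC -Dp.
have sz_r : (n < (size r).+1)%N.
  by rewrite -(size_prod_XsubC r id) -Dp size_XnsubC.
have [|z] := hasP (cyclic.has_prim_root n_gt0 rn1 _ sz_r); last by exists z.
by rewrite -separable_prod_XsubC -Dp separable_Xn_sub_1 // pnatr_eq0 -lt0n.
Qed.

Lemma norm_prim_root (C : numClosedFieldType) n (w : C) :
  n.-primitive_root w -> `|w| = 1.
Proof.
move=> pw; have n0 := prim_order_gt0 pw.
apply/eqP; rewrite -(pexpr_eq1 n0 (normr_ge0 w)) -normrX (prim_expr_order pw).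
by rewrite normr1.
Qed.

(** Orthogonality of the characters of the cyclic group of order M: the only
    tool from Fourier analysis that is used. *)
Lemma root_orthogonality (C : numClosedFieldType) M (w : C) u v :
  M.-primitive_root w -> (u < M)%N -> (v < M)%N ->
  \sum_(l < M) w ^+ (l * u) * (w ^+ (l * v))^* = if u == v then M%:R else 0.
Proof.
move=> pw uM vM; have w1 := norm_prim_root pw.
have E l : w ^+ (l * u) * (w ^+ (l * v))^* = (w ^+ u * (w ^+ v)^*) ^+ l.
  by rewrite exprMn -rmorphXn /= -!exprM ![(l * _)%N]mulnC.
under eq_bigr do rewrite E.
have wv1 : w ^+ v * (w ^+ v)^* = 1 by rewrite -normCK normrX w1 !expr1n.
case: eqVneq => [->|uv].
  under eq_bigr do rewrite wv1 expr1n.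
  by rewrite sumr_const card_ord.
set t := _ * _^*; have tM : t ^+ M = 1.
  by rewrite exprMn -rmorphXn -!exprM mulnC exprM (mulnC v) exprM
    (prim_expr_order pw) !expr1n rmorph1 mulr1.
have t1 : t - 1 != 0.
  apply: contra uv; rewrite subr_eq0 => /eqP t1.
  have : w ^+ u = w ^+ v.
    by rewrite -[LHS]mulr1 -wv1 [w ^+ v * _]mulrC mulrA -/t t1 mul1r.
  by move/eqP; rewrite (eq_prim_root_expr pw) !modn_small.
by apply: (mulfI t1); rewrite -subrX1 tM subrr mulr0.
Qed.

Section Forms.
Variable C : numClosedFieldType.

Lemma adjM m n p (A : 'M[C]_(m, n)) (B : 'M[C]_(n, p)) :
  (A *m B)^t* = B^t* *m A^t*.
Proof. by rewrite trmx_mul map_mxM. Qed.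

Lemma adjD m n (A B : 'M[C]_(m, n)) : (A + B)^t* = A^t* + B^t*.
Proof. by rewrite linearD /= map_mxD. Qed.

Lemma adjB m n (A B : 'M[C]_(m, n)) : (A - B)^t* = A^t* - B^t*.
Proof. by rewrite linearB /= map_mxB. Qed.

Lemma adjZ m n a (A : 'M[C]_(m, n)) : (a *: A)^t* = a^* *: A^t*.
Proof. by rewrite linearZ /= map_mxZ. Qed.

Lemma adj1 n : (1%:M : 'M[C]_n)^t* = 1%:M.
Proof. by rewrite trmx1 map_mx1. Qed.

Lemma adj_sum (I : Type) (r : seq I) (P : pred I) m n (F : I -> 'M[C]_(m, n)) :
  (\sum_(i <- r | P i) F i)^t* = \sum_(i <- r | P i) (F i)^t*.
Proof.
elim/big_rec2: _ => [|i A B _ <-]; first by rewrite trmx0 map_mx0.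
by rewrite adjD.
Qed.

Definition qf n (G : 'M[C]_n) (v : 'rV[C]_n) : C := (v *m G *m v^t*) 0 0.

Definition psd n (G : 'M[C]_n) := forall v, 0 <= qf G v.

Lemma qf_congr n m (G : 'M[C]_m) (A : 'M[C]_(n, m)) v :
  qf (A *m G *m A^t*) v = qf G (v *m A).
Proof. by rewrite /qf adjM !mulmxA. Qed.

Lemma qfB n (G H : 'M[C]_n) v : qf (G - H) v = qf G v - qf H v.
Proof. by rewrite /qf mulmxBr mulmxBl !mxE. Qed.

Lemma qf0 n (G : 'M[C]_n) : qf G 0 = 0.
Proof. by rewrite /qf !mul0mx mxE. Qed.

Lemma qf1E n (v : 'rV[C]_n) : qf 1%:M v = \sum_i `|v 0 i| ^+ 2.
Proof.
rewrite /qf mulmx1 mxE; apply: eq_bigr => i _.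
by rewrite !mxE normCK.
Qed.

Lemma psd1 n : psd (1%:M : 'M[C]_n).
Proof. by move=> v; rewrite qf1E sumr_ge0 // => i _; rewrite exprn_ge0. Qed.

Lemma qf_sum n (G : 'M[C]_n) (I : finType) (a : I -> C) (y : I -> 'rV[C]_n) :
  qf G (\sum_i a i *: y i)
  = \sum_i \sum_j (a i * (a j)^*) * (y i *m G *m (y j)^t*) 0 0.
Proof.
rewrite /qf adj_sum !mulmx_suml summxE; apply: eq_bigr => i _.
rewrite mulmx_sumr summxE; apply: eq_bigr => j _.
by rewrite adjZ -scalemxAr -!scalemxAl scalerA mxE [_^* * _]mulrC.
Qed.

(** The identity holds for any sesquilinear form on the coefficients, positive or
    not, by expanding and using orthogonality of characters. *)
Lemma parseval n (G : 'M[C]_n) M (w : C) (y : 'I_M -> 'rV[C]_n) :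
  M.-primitive_root w ->
  \sum_(l < M) qf G (\sum_(u < M) w ^+ (l * u) *: y u)
  = M%:R * \sum_(u < M) qf G (y u).
Proof.
move=> pw; under eq_bigr do rewrite qf_sum.
rewrite exchange_big /= mulr_sumr; apply: eq_bigr => u _.
rewrite exchange_big /= (bigD1 u) //= [X in _ + X]big1 ?addr0; last first.
  move=> v vu; rewrite -mulr_suml (root_orthogonality pw) //.
  by rewrite eq_sym val_eqE (negPf vu) mul0r.
by rewrite -mulr_suml (root_orthogonality pw) // eqxx.
Qed.

(** Row vectors are carried as the first row of a square matrix, so that vector
    polynomials can be multiplied by matrix polynomials inside one ring. *)
Lemma parseval_poly n (G : 'M[C]_n.+1) M (w : C) (p : {poly 'M[C]_n.+1}) :
  M.-primitive_root w -> (size p <= M)%N ->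
  \sum_(l < M) qf G (row 0 p.[(w ^+ l)%:M])
  = M%:R * \sum_(u < M) qf G (row 0 p`_u).
Proof.
move=> pw sp; rewrite -(parseval G (fun u : 'I_M => row 0 p`_u) pw).
apply: eq_bigr => l _; congr qf.
rewrite (horner_coef_wide _ sp) linear_sum; apply: eq_bigr => u _ /=.
by rewrite -rmorphXn -exprM -[_ * _]/(_ *m _) mul_mx_scalar linearZ.
Qed.

End Forms.

(** * Intertwining matrices with polynomial symbols *)

Section Model.
Variable C : numClosedFieldType.

(** Evaluation of a scalar polynomial in d variables at a tuple of ring elements.
    The map [emb] embeds the scalars: the ring is used for the field itself, for
    matrices, and for polynomials with matrix coefficients. *)
Definition mpeval (R : nzRingType) (emb : C -> R) d K
    (c : {ffun 'I_d -> 'I_K} -> C) (Z : 'I_d -> R) : R :=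
  \sum_a emb (c a) * \prod_j Z j ^+ a j.

Lemma comm_scalar n (A : 'M[C]_n.+1) (z : C) : A * z%:M = z%:M * A.
Proof. by rewrite -!mulmxE scalar_mxC. Qed.

Lemma horner_scalarM n (p q : {poly 'M[C]_n.+1}) (z : C) :
  (p * q).[z%:M] = p.[z%:M] * q.[z%:M].
Proof. by rewrite hornerM_comm // /comm_poly comm_scalar. Qed.

Lemma horner_scalarX n (p : {poly 'M[C]_n.+1}) (z : C) k :
  (p ^+ k).[z%:M] = p.[z%:M] ^+ k.
Proof.
by elim: k => [|k IHk]; rewrite ?expr0 ?hornerC // !exprS horner_scalarM IHk.
Qed.

Lemma horner_mpeval n d K (c : {ffun 'I_d -> 'I_K} -> C)
    (F : 'I_d -> {poly 'M[C]_n.+1}) (z : C) :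
  (mpeval (fun x => x%:M%:P) c F).[z%:M]
  = mpeval (fun x => x%:M) c (fun j => (F j).[z%:M]).
Proof.
rewrite /mpeval horner_sum; apply: eq_bigr => a _.
rewrite horner_scalarM hornerC; congr (_ * _).
rewrite (big_morph (fun p => p.[z%:M]) (fun p q => horner_scalarM p q z)
  (hornerC _ _)).
by apply: eq_bigr => j _; rewrite horner_scalarX.
Qed.

Section Intertwining.
Variables (n m N : nat) (B : 'M[C]_n.+1) (X : 'M[C]_(n.+1, m.+1)).
Hypothesis BN : B ^+ N = 0.

Lemma nilpotent_ge k : (N <= k)%N -> B ^+ k = 0.
Proof. by move=> /subnK <-; rewrite exprD BN mulr0. Qed.

(** The compression to the embedded space of the Toeplitz operator with analytic
    symbol F: a vector v is embedded as the sequence of the v B^k X, on which B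
    acts as the backward shift.  Only N terms matter as B^N = 0. *)
Definition symbol (F : {poly 'M[C]_m.+1}) : 'M[C]_(n.+1, m.+1) :=
  \sum_(g < N) B ^+ g *m X *m F`_g.

Definition intertwines (P : 'M[C]_n.+1) (F : {poly 'M[C]_m.+1}) :=
  P * B = B * P /\ P *m X = symbol F.

Lemma intertwines_scalar z : (0 < N)%N -> intertwines z%:M z%:M%:P.
Proof.
move=> N0; split; first by rewrite comm_scalar.
rewrite /symbol -(prednK N0) big_ord_recl big1 ?addr0 => [|i _].
  by rewrite expr0 mul1mx coefC scalar_mxC.
by rewrite coefC mulmx0.
Qed.

Lemma intertwinesD P1 P2 F1 F2 :
  intertwines P1 F1 -> intertwines P2 F2 -> intertwines (P1 + P2) (F1 + F2).
Proof.
move=> [c1 e1] [c2 e2]; split; first by rewrite mulrDl mulrDr c1 c2.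
rewrite mulmxDl e1 e2 -big_split; apply: eq_bigr => g _.
by rewrite coefD mulmxDr.
Qed.

(** Analytic Toeplitz operators compose by multiplying their symbols, because P1
    commutes with B; the terms lost by truncating both sums contain B^N. *)
Lemma intertwinesM P1 P2 F1 F2 :
  intertwines P1 F1 -> intertwines P2 F2 -> intertwines (P1 * P2) (F1 * F2).
Proof.
move=> [c1 e1] [c2 e2]; split; first by rewrite -mulrA c2 mulrA c1 mulrA.
have cX g : P1 *m B ^+ g = B ^+ g *m P1.
  by have : GRing.comm P1 (B ^+ g) by apply: commrX.
rewrite -[P1 * P2]/(P1 *m P2) -mulmxA e2 mulmx_sumr.
have -> : \sum_(j < N) P1 *m (B ^+ j *m X *m F2`_j)
   = \sum_(j < N) \sum_(i < N) B ^+ (j + i) *m X *m (F1`_i *m F2`_j).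
  apply: eq_bigr => j _; rewrite !mulmxA cX -[_ *m X]mulmxA e1.
  rewrite mulmx_sumr mulmx_suml; apply: eq_bigr => i _.
  by rewrite exprD -[_ * _]/(_ *m _) !mulmxA.
have -> : \sum_(j < N) \sum_(i < N) B ^+ (j + i) *m X *m (F1`_i *m F2`_j)
   = \sum_(j < N) \sum_(g < N | (j <= g)%N) B ^+ g *m X *m (F1`_(g - j) *m F2`_j).
  apply: eq_bigr => j _.
  rewrite -(big_mkord xpredT
    (fun i => B ^+ (j + i) *m X *m (F1`_i *m F2`_j))).
  rewrite -(big_mkord (fun g => (j <= g)%N)
    (fun g => B ^+ g *m X *m (F1`_(g - j) *m F2`_j))).
  rewrite (@big_cat_nat _ _ _ (N - j)) ?leq_subr //=.
  rewrite [X in _ + X = _]big_nat_cond [X in _ + X = _]big1 ?addr0; last first.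
    move=> i /andP[/andP[li _] _]; rewrite nilpotent_ge ?mul0mx //.
    by rewrite -leq_subLR.
  have jN : (j <= N)%N by exact: ltnW.
  rewrite [RHS](@big_cat_nat _ _ _ j) //=.
  rewrite [X in _ = X + _]big_nat_cond [X in _ = X + _]big_pred0 ?add0r; last first.
    by move=> i; apply: negbTE; rewrite -!andbA; apply/negP => /and3P[_ + +];
      rewrite ltnNge => /negP.
  rewrite -[X in _ = \sum_(X <= _ < _ | _) _]add0n big_addn; apply: congr_big_nat => //.
  - by move=> i _; rewrite leq_addl.
  - by move=> i _; rewrite addnK addnC.
rewrite [RHS]/symbol (exchange_big_dep xpredT) //=.
apply: eq_bigr => g _; rewrite coefMr mulmx_sumr.
rewrite -(big_mkord xpredT (fun j => B ^+ g *m X *m (F1`_(g - j) * F2`_j))).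
rewrite -(big_mkord (fun j => (j <= g)%N)
   (fun j => B ^+ g *m X *m (F1`_(g - j) *m F2`_j))).
rewrite [LHS](@big_cat_nat _ _ _ g.+1) //=.
rewrite [X in _ + X = _]big_nat_cond [X in _ + X = _]big_pred0 ?addr0; last first.
  by move=> i; apply: negbTE; rewrite -!andbA; apply/negP => /and3P[+ _ +];
    rewrite ltnNge => /negP.
rewrite big_nat_cond [RHS]big_nat_cond; apply: eq_bigl => i.
by rewrite ltnS andbT; case: (i <= g)%N.
Qed.

Lemma intertwines_mpeval d K (c : {ffun 'I_d -> 'I_K} -> C) Z F :
  (0 < N)%N -> (forall j, intertwines (Z j) (F j)) ->
  intertwines (mpeval (fun x => x%:M) c Z) (mpeval (fun x => x%:M%:P) c F).
Proof.
move=> N0 h; rewrite /mpeval.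
have hX P G k : intertwines P G -> intertwines (P ^+ k) (G ^+ k).
  move=> PG; elim: k => [|k IHk]; first exact: intertwines_scalar.
  by rewrite !exprS; apply: intertwinesM.
elim/big_rec2: _ => [|a P G _ PG].
  have z0 p : (0%:M : 'M[C]_p) = 0 by rewrite -scalemx1 scale0r.
  by have := intertwines_scalar 0 N0; rewrite !z0 polyC0.
apply: intertwinesD => //; apply: intertwinesM; first exact: intertwines_scalar.
elim/big_rec2: _ => [|j P' G' _ PG']; first exact: intertwines_scalar.
by apply: intertwinesM => //; apply: hX.
Qed.

(** If v |-> (v B^k X)_k is isometric from the form G to the sequences with values
    in the form H, and P acts there as the compression of a multiplication by F,
    then a bound on F on the unit circle is a bound on P.  The sequence is read
    backwards, as the coefficients of a polynomial of degree less than N: the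
    coefficients of its product with F which have index less than N are those
    attached to v P, and Parseval applies to all of them. *)
Lemma model_bound (G : 'M[C]_n.+1) (H : 'M[C]_m.+1) P F (kap : C) :
  psd H -> (forall v, qf G v = \sum_(k < N) qf H (v *m B ^+ k *m X)) ->
  intertwines P F ->
  (forall z : C, `|z| = 1 -> forall e, qf H (e *m F.[z%:M]) <= kap * qf H e) ->
  forall v, qf G (v *m P) <= kap * qf G v.
Proof.
move=> H0 GH [cPB ePX] bnd v.
pose dl : 'cV[C]_m.+1 := const_mx 1.
have row_dl (w : 'rV[C]_m.+1) : row 0 (dl *m w) = w.
  by apply/rowP => i; rewrite !mxE big_ord1 !mxE mul1r.
pose Xt : {poly 'M[C]_m.+1} :=
  \poly_(u < N) (dl *m (v *m B ^+ (N - u.+1) *m X)).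
have coefXt s : (s < N)%N -> row 0 (Xt * F)`_(N - s.+1) = v *m P *m B ^+ s *m X.
  move=> sN; rewrite coefMr linear_sum /=.
  have -> : v *m P *m B ^+ s *m X
     = \sum_(j < N) v *m B ^+ (s + j) *m X *m F`_j.
    have cPs : P *m B ^+ s = B ^+ s *m P.
      by have : GRing.comm P (B ^+ s) by apply: commrX.
    rewrite -(mulmxA v) cPs mulmxA -mulmxA ePX mulmx_sumr; apply: eq_bigr => j _.
    by rewrite exprD -[_ * _]/(_ *m _) !mulmxA.
  rewrite -(big_mkord xpredT (fun j => row 0 (Xt`_(N - s.+1 - j) * F`_j))).
  rewrite -(big_mkord xpredT (fun j => v *m B ^+ (s + j) *m X *m F`_j)).
  rewrite [RHS](@big_cat_nat _ _ _ (N - s.+1).+1) //=; last by rewrite subnSK // leq_subr.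
  rewrite [X in _ = _ + X]big_nat_cond [X in _ = _ + X]big1 ?addr0; last first.
    move=> j /andP[/andP[lj _] _]; rewrite nilpotent_ge ?mulmx0 ?mul0mx //.
    by rewrite -leq_subLR -subnSK.
  rewrite !big_nat; apply: eq_bigr => j /andP[_]; rewrite ltnS => lj.
  rewrite coef_poly; case: ltnP => [_|]; last first.
    by move=> /leq_trans/(_ (leq_subr _ _)); rewrite leqNgt ltn_subrL (leq_ltn_trans _ sN).
  rewrite -[_ * _]/(_ *m _) row_mul row_dl.
  congr (_ *m B ^+ _ *m _ *m _).
  by move: lj; clear -sN; lia.
(* M exceeds every degree that occurs, so that Parseval has no aliasing. *)
pose M := (N + size F).+1.
have [w pw] := @closed_prim_root_exists C M isT.
have M0 : (0 : C) < M%:R by rewrite ltr0n.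
have sXt : (size Xt <= N)%N := size_poly _ _.
have sXtF : (size (Xt * F)%R <= M)%N.
  apply: leq_trans (size_polyMleq _ _) _; rewrite /M.
  by apply: leq_trans (leq_pred _) _; rewrite ltnW // ltnS leq_add2r.
have sXtM : (size Xt <= M)%N by rewrite (leq_trans sXt) // /M leqW // leq_addr.
have NM : (N <= M)%N by rewrite /M leqW // leq_addr.
rewrite -(ler_pM2l M0) mulrCA.
have EG : qf G v = \sum_(u < M) qf H (row 0 Xt`_u).
  rewrite GH -(big_mkord xpredT (fun u => qf H (row 0 Xt`_u))).
  rewrite (@big_cat_nat _ _ _ N) //= [X in _ + X]big_nat_cond.
  rewrite [X in _ + X]big1 ?addr0; last first.
    move=> j /andP[/andP[lj _] _]; rewrite coef_poly ltnNge lj /=.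
    by rewrite linear0 qf0.
  rewrite big_mkord (reindex_inj rev_ord_inj) /=; apply: eq_bigr => k _.
  by rewrite coef_poly ltn_ord row_dl.
have LG : qf G (v *m P) <= \sum_(u < M) qf H (row 0 (Xt * F)`_u).
  rewrite GH -(big_mkord xpredT (fun u => qf H (row 0 (Xt * F)`_u))).
  rewrite [leRHS](@big_cat_nat _ _ _ N) //= -[leLHS]addr0 lerD ?sumr_ge0 //.
  rewrite big_mkord [leRHS](reindex_inj rev_ord_inj) /=.
  by apply: ler_sum => k _; rewrite coefXt.
apply: (@le_trans _ _ (M%:R * \sum_(u < M) qf H (row 0 (Xt * F)`_u))).
  by rewrite ler_pM2l.
rewrite EG -(parseval_poly H pw sXtF) -(parseval_poly H pw sXtM) mulr_sumr.
apply: ler_sum => l _; rewrite horner_scalarM.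
rewrite -[_ * _]/(_ *m _) row_mul.
by apply: bnd; rewrite normrX (norm_prim_root pw) expr1n.
Qed.

End Intertwining.
End Model.

(** * Unitary extensions and commuting unitaries *)

Section Unitary.
Variable C : numClosedFieldType.

(** The factor is the inverse of the diagonalizing unitary times the square root
    of the diagonal part. *)
Lemma psd_factor n (G : 'M[C]_n) :
  G^t* = G -> psd G -> exists B : 'M[C]_n, G = B *m B^t*.
Proof.
move=> Gh Gp; have Gn : G \is normalmx by apply/normalmxP; rewrite Gh.
have /orthomx_spectralP := Gn.
set P := spectralmx G; set s := spectral_diag G => EG.
have Pu : P \is unitarymx by exact: spectral_unitarymx.
rewrite invmx_unitary // in EG.
have s0 i : 0 <= s 0 i.
  have := Gp (row i P); rewrite /qf EG.
  suff -> : (row i P *m (P^t* *m diag_mx s *m P) *m (row i P)^t*) 0 0 = s 0 i by [].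
  rewrite !rowE adjM !mulmxA mulmxtVK // mulmxtVK //.
  rewrite -rowE row_diag_mx -scalemxAl mxE mxE.
  rewrite (bigD1 i) //= !mxE !eqxx /= conjC1 big1 => [|j ji].
    by rewrite addr0 mulr1 mulr1.
  by rewrite !mxE (negPf ji) andbF mul0r.
exists (P^t* *m diag_mx (\row_i sqrtC (s 0 i))).
rewrite adjM trmxCK {1}EG !mulmxA; congr (_ *m _).
rewrite -!mulmxA; congr (_ *m _).
rewrite tr_diag_mx map_diag_mx mulmx_diag; congr diag_mx.
apply/rowP => i; rewrite !mxE /= -normCK ger0_norm ?sqrtC_ge0 //.
by rewrite sqrtCK.
Qed.

Lemma ortho_complement k m (S : 'M[C]_(k, m)) : S \is unitarymx ->
  exists T : 'M[C]_(m - k, m), [/\ T \is unitarymx, S *m T^t* = 0,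
     T *m S^t* = 0 & S^t* *m S + T^t* *m T = 1%:M].
Proof.
move=> Su; have rS := mxrank_unitary Su.
have [T [Tu ST TS]] : exists T : 'M[C]_(m - k, m),
    [/\ T \is unitarymx, S *m T^t* = 0 & T *m S^t* = 0].
  have := rank_ortho S; rewrite rS => <-.
  set V := orthomx _ _ _; exists (schmidt (row_base V)).
  set R := row_base V.
  have su : schmidt R \is unitarymx by rewrite schmidt_unitarymx ?rank_leq_col.
  have TS : schmidt R *m S^t* = 0.
    by apply/orthomx1P; rewrite eqmx_schmidt_free ?row_base_free // eq_row_base.
  split=> //; have := congr1 (fun M => M^t*) TS.
  by rewrite adjM trmxCK trmx0 map_mx0.
exists T; split=> //.
have full : row_full (col_mx S T).
  rewrite -col_leq_rank (_ : \rank (col_mx S T) = k + (m - k))%N.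
    by rewrite -leq_subLR.
  apply: mxrank_unitary; apply/unitarymxP.
  rewrite tr_col_mx map_row_mx mul_col_row ST TS (unitarymxP Su) (unitarymxP Tu).
  by rewrite -scalar_mx_block.
apply: (row_full_inj full); rewrite mulmx1 mulmxDr !mulmxA !mul_col_mx.
rewrite (unitarymxP Su) (unitarymxP Tu) ST TS !mul1mx !mul0mx add_col_mx.
by rewrite addr0 add0r.
Qed.

(** Equal Gram matrices make X |-> Y a partial isometry between the row spaces;
    in finite dimension the orthogonal complements of the row spaces have the
    same dimension, so a unitary map between them completes it. *)
Lemma unitary_extension n m (X Y : 'M[C]_(n, m)) :
  X *m X^t* = Y *m Y^t* -> exists2 U : 'M[C]_m, U \is unitarymx & X *m U = Y.
Proof.
move=> XY.
have ker k (A : 'M[C]_(k, n)) : A *m X = 0 -> A *m Y = 0.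
  move=> AX; have : (A *m Y) *m (A *m Y)^t* = 0.
    by rewrite adjM mulmxA -(mulmxA A) -XY !mulmxA AX !mul0mx.
  move=> h; apply/row_matrixP => i; rewrite row0; apply/rowP => j.
  have /eqP := congr1 (fun M : 'M_k => M i i) h; rewrite !mxE psumr_eq0; last first.
    by move=> l _; rewrite !mxE -normCK exprn_ge0.
  move=> /allP/(_ j (mem_index_enum _))/eqP; rewrite !mxE -normCK => /eqP.
  by rewrite sqrf_eq0 normr_eq0 => /eqP.
have [k [S [Su SX]]] : exists k (S : 'M[C]_(k, m)),
    S \is unitarymx /\ (S :=: X)%MS.
  exists (\rank X), (schmidt (row_base X)).
  split; first by rewrite schmidt_unitarymx ?rank_leq_col.
  by apply: (eqmx_trans (eqmx_schmidt_free _)); rewrite ?row_base_free //;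
    exact: eq_row_base.
have /submxP[W SW] : (S <= X)%MS by rewrite SX.
have /submxP[L XL] : (X <= S)%MS by rewrite SX.
have [S' ES'] : exists S', S' = W *m Y by eexists.
have YL : Y = L *m S'.
  apply/eqP; rewrite -subr_eq0 ES' mulmxA -[X in X - _]mul1mx -mulmxBl.
  apply/eqP/ker; rewrite mulmxBl mul1mx -mulmxA -SW -XL subrr.
  by [].
have Su' : S' \is unitarymx.
  apply/unitarymxP; rewrite ES' adjM mulmxA -(mulmxA W) -XY.
  by rewrite mulmxA -SW -mulmxA -adjM -SW (unitarymxP Su).
have [T [Tu ST TS PT]] := ortho_complement Su.
have [T' [Tu' ST' TS' PT']] := ortho_complement Su'.
exists (S^t* *m S' + T^t* *m T').
  apply/unitarymxP; rewrite adjD !adjM !trmxCK mulmxDl !mulmxDr.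
  rewrite !mulmxA ![_ *m S' *m _]mulmxtVK // ![_ *m T' *m T'^t*]mulmxtVK //.
  rewrite -(mulmxA _ S') ST' -(mulmxA _ T') TS' !mulmx0 !mul0mx addr0 add0r.
  by [].
rewrite mulmxDr YL XL !mulmxA mulmxtVK // -(mulmxA L S) ST mulmx0 mul0mx addr0.
by [].
Qed.

(** The only non-scalar entries are U and z U^*, which are diagonal in a common
    orthonormal basis with unimodular eigenvalues. *)
Lemma unitary_mpeval_bound n d K (c : {ffun 'I_d -> 'I_K} -> C) kap
    (i0 i1 : 'I_d) (t : 'I_d -> C) (z : C) (U : 'M[C]_n.+1) :
  (forall s, (forall j, `|s j| = 1) -> `|mpeval idfun c s| ^+ 2 <= kap) ->
  U \is unitarymx -> `|z| = 1 -> (forall j, `|t j| = 1) ->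
  forall e, qf 1%:M (e *m mpeval (fun x => x%:M) c
    (fun j => if j == i0 then U else if j == i1 then z *: U^t* else (t j)%:M))
  <= kap * qf 1%:M e.
Proof.
move=> hc Uu z1 t1 e.
have Un : U \is normalmx.
  by apply/normalmxP; rewrite (unitarymxP Uu) (mulmx1C (unitarymxP Uu)).
have /orthomx_spectralP := Un.
set Q := spectralmx U; set l := spectral_diag U => EU.
have Qu : Q \is unitarymx by exact: spectral_unitarymx.
have Qunit := unitarymx_unit Qu.
pose D (s : 'I_n.+1 -> C) := invmx Q *m diag_mx (\row_k s k) *m Q.
have Deq s s' : s =1 s' -> D s = D s'.
  by move=> ss; rewrite /D; congr (_ *m diag_mx _ *m _); apply/rowP => k; rewrite !mxE.
have EUl : U = D (fun k => l 0 k).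
  by rewrite {1}EU /D; congr (_ *m diag_mx _ *m _); apply/rowP => k; rewrite mxE.
have DM s s' : D s * D s' = D (fun k => s k * s' k).
  rewrite -!mulmxE /D !mulmxA mulmxK // -(mulmxA (invmx Q)) mulmx_diag.
  by congr (_ *m diag_mx _ *m _); apply/rowP => k; rewrite !mxE.
have DD s s' : D s + D s' = D (fun k => s k + s' k).
  rewrite /D -mulmxDl -mulmxDr -linearD; congr (_ *m diag_mx _ *m _).
  by apply/rowP => k; rewrite !mxE.
have DC x : x%:M = D (fun=> x).
  rewrite /D (_ : diag_mx _ = x%:M); last first.
    by rewrite -diag_const_mx; congr diag_mx; apply/rowP => k; rewrite !mxE.
  by rewrite -mulmxA mul_scalar_mx -scalemxAr mulVmx // scalemx1.
have Dadj s : (D s)^t* = D (fun k => (s k)^*).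
  rewrite /D invmx_unitary // !adjM trmxCK mulmxA tr_diag_mx map_diag_mx.
  by congr (_ *m diag_mx _ *m _); apply/rowP => k; rewrite !mxE.
have Dinj s s' : D s = D s' -> s =1 s'.
  move=> /(congr1 (fun M => Q *m M *m invmx Q)).
  rewrite /D !mulmxA !mulmxK // !mulmxV // !mul1mx => /matrixP E k.
  by have := E k k; rewrite !mxE eqxx !mulr1n.
have l1 k : `|l 0 k| = 1.
  have := unitarymxP Uu; rewrite mulmxE EUl Dadj DM -[1%:M]/(1%:M) DC.
  move=> /Dinj/(_ k) /=; rewrite -normCK => /eqP.
  by rewrite (pexpr_eq1 (ltn0Sn 1) (normr_ge0 _)) => /eqP.
pose Z k j := if j == i0 then l 0 k else if j == i1 then z * (l 0 k)^* else t j.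
have Z1 k j : `|Z k j| = 1.
  rewrite /Z; case: ifP => // _; case: ifP => // _.
  by rewrite normrM norm_conjC l1 z1 mulr1.
have EZ : mpeval (fun x => x%:M) c
    (fun j => if j == i0 then U else if j == i1 then z *: U^t* else (t j)%:M)
    = D (fun k => mpeval idfun c (Z k)).
  rewrite /mpeval.
  have DX s p : D s ^+ p = D (fun k => s k ^+ p).
    elim: p => [|p IHp]; first by rewrite expr0 -[1]/(1%:M) DC.
    by rewrite exprS IHp DM; apply: Deq => k; rewrite exprS.
  have -> : D (fun k => \sum_a c a * \prod_j Z k j ^+ a j)
     = \sum_a D (fun k => c a * \prod_j Z k j ^+ a j).
    elim: (index_enum _) => [|a r IHr].
      rewrite big_nil; transitivity (0%:M : 'M[C]_n.+1); last first.
        by rewrite -scalemx1 scale0r.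
      rewrite DC.
      by apply: Deq => k; rewrite big_nil.
    rewrite big_cons -IHr DD.
    by apply: Deq => k; rewrite big_cons.
  apply: eq_bigr => a _; rewrite -DM DC; congr (_ * _).
  elim: (index_enum _) => [|j r IHr].
    rewrite big_nil -[LHS]/(1%:M) DC.
    by apply: Deq => k; rewrite big_nil.
  rewrite big_cons IHr.
  have -> : (if j == i0 then U else if j == i1 then z *: U^t* else (t j)%:M)
     = D (fun k => Z k j).
    rewrite /Z; case: (j == i0) => //; case: (j == i1); last by rewrite DC.
    by rewrite -mul_scalar_mx mulmxE DC EUl Dadj DM.
  rewrite DX DM.
  by apply: Deq => k; rewrite big_cons.
rewrite {}EZ; set S := fun k => _.
have -> : qf 1%:M (e *m D S) = qf 1%:M (e *m invmx Q *m diag_mx (\row_k S k)).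
  rewrite /qf !mulmx1 /D !mulmxA !adjM !mulmxA mulmxtVK //.
have -> : qf 1%:M e = qf 1%:M (e *m invmx Q).
  by rewrite /qf !mulmx1 invmx_unitary // !adjM !trmxCK !mulmxA mulmxKtV.
rewrite !qf1E mulr_sumr; apply: ler_sum => k _.
rewrite mul_mx_diag !mxE normrM exprMn mulrC.
by apply: ler_wpM2r; rewrite ?exprn_ge0 // /S; apply: hc.
Qed.

End Unitary.

(** * The von Neumann inequality for commuting nilpotent matrices *)

Section MatrixVonNeumann.
Variable C : numClosedFieldType.

Section Brehmer.
Variables (n d : nat) (A : 'I_d -> 'M[C]_n) (G : 'M[C]_n) (r2 : C).
Hypothesis G_psd : psd G.
Hypothesis G_contr : forall j v, qf G (v *m A j) <= r2 * qf G v.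
Hypothesis r2_ge0 : 0 <= r2.

Definition defect (B H : 'M[C]_n) := H - B *m H *m B^t*.

Lemma qf_defect B H v : qf (defect B H) v = qf H v - qf H (v *m B).
Proof. by rewrite /defect qfB qf_congr. Qed.

(** The positivity of these alternating sums is the condition of Brehmer for the
    existence of a regular unitary dilation. *)
Definition brehmer (s : seq 'I_d) := foldr (fun j => defect (A j)) G s.

(** Each new operation subtracts the current form evaluated at v A_j, which is at
    most G at v A_j, hence at most r2 times G at v: the losses add up. *)
Lemma brehmer_bounds s v : (size s)%:R * r2 <= 1 ->
  (1 - (size s)%:R * r2) * qf G v <= qf (brehmer s) v <= qf G v.
Proof.
elim: s v => [|j s IHs] v /=; first by rewrite mul0r subr0 mul1r lexx.
move=> sr; have sr' : (size s)%:R * r2 <= 1.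
  by apply: le_trans sr; rewrite ler_wpM2r // ler_nat.
have /andP[lo hi] := IHs v sr'; have /andP[lo' hi'] := IHs (v *m A j) sr'.
have p : 0 <= qf (brehmer s) (v *m A j).
  by apply: le_trans lo'; rewrite mulr_ge0 ?subr_ge0.
rewrite qf_defect; apply/andP; split; last by rewrite lerBlDr ler_wpDr.
have -> : (1 - (size s).+1%:R * r2) * qf G v
    = (1 - (size s)%:R * r2) * qf G v - r2 * qf G v by rewrite -natr1; ring.
by rewrite lerB // (le_trans hi').
Qed.

Lemma brehmer_psd s : (size s)%:R * r2 <= 1 -> psd (brehmer s).
Proof.
move=> sr v; have /andP[lo _] := brehmer_bounds v sr.
by apply: le_trans lo; rewrite mulr_ge0 ?subr_ge0.
Qed.

Lemma brehmer_herm s : G^t* = G -> (brehmer s)^t* = brehmer s.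
Proof.
move=> Gh; elim: s => //= j s IHs.
by rewrite /defect adjB !adjM trmxCK IHs mulmxA.
Qed.

End Brehmer.

(** H = sum of B^k (H - B H B^* ) B^k^* for a nilpotent B, as in the isometric
    embedding of a pure contraction in the Hardy space of its defect space. *)
Lemma telescope_form n (B H : 'M[C]_n.+1) N v : B ^+ N = 0 ->
  qf H v = \sum_(k < N) qf (defect B H) (v *m B ^+ k).
Proof.
move=> BN.
have E M : qf H v = \sum_(k < M) qf (defect B H) (v *m B ^+ k)
                   + qf H (v *m B ^+ M).
  elim: M => [|M IHM]; first by rewrite big_ord0 add0r expr0 mulmx1.
  rewrite big_ord_recr /= qf_defect IHM exprSr -mulmxE !mulmxA.
  by rewrite addrA addrNK.
by rewrite (E N) BN mulmx0 qf0 addr0.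
Qed.

(** One variable of the tuple becomes a shift, that is the multiplication by the
    variable of the symbol, while the others, which commute with it, act on
    coefficients; on the circle the variable takes unimodular scalar values. *)
Lemma peel n d K (c : {ffun 'I_d -> 'I_K} -> C) kap N (i : 'I_d)
    (Z : 'I_d -> 'M[C]_n.+1) (H : 'M[C]_n.+1) :
  (0 < N)%N -> (forall j, Z j * Z i = Z i * Z j) -> Z i ^+ N = 0 ->
  psd (defect (Z i) H) ->
  (forall z : C, `|z| = 1 -> forall e,
     qf (defect (Z i) H)
       (e *m mpeval (fun x => x%:M) c (fun j => if j == i then z%:M else Z j))
     <= kap * qf (defect (Z i) H) e) ->
  forall v, qf H (v *m mpeval (fun x => x%:M) c Z) <= kap * qf H v.
Proof.
move=> N0 cZ ZN dp bnd.
pose F j : {poly 'M[C]_n.+1} := if j == i then 'X else (Z j)%:P.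
apply: (@model_bound C n n N (Z i) 1%:M ZN H (defect (Z i) H)
   _ (mpeval (fun x => x%:M%:P) c F)) => //.
- move=> v; rewrite (telescope_form H v ZN); apply: eq_bigr => k _.
  by rewrite mulmx1.
- apply: intertwines_mpeval => // j; split=> //.
  rewrite mulmx1 /symbol /F; case: (eqVneq j i) => [->|ji].
    case: (ltnP 1 N) => N1.
      rewrite (bigD1 (Ordinal N1)) //= coefX eqxx expr1 !mulmx1 big1 ?addr0 //.
      by move=> g; rewrite -val_eqE /= coefX => /negPf->; rewrite mulmx0.
    have N1' : N = 1%N by apply/eqP; rewrite eqn_leq N1.
    by move: ZN; rewrite N1' expr1 => ->; rewrite big_ord1 coefX mulmx0.
  rewrite -(prednK N0) big_ord_recl big1 ?addr0 => [|g _].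
    by rewrite expr0 !mul1mx coefC.
  by rewrite coefC mulmx0.
- move=> z z1 e; rewrite horner_mpeval.
  rewrite (_ : (fun j => _) = fun j => if j == i then z%:M else Z j).
    exact: bnd.
  apply/funext => j; rewrite /F; case: ifP => _; first by rewrite hornerX.
  by rewrite hornerC.
Qed.

Lemma symbol_affine n m N (B : 'M[C]_n.+1) (X : 'M[C]_(n.+1, m.+1)) p q :
  (0 < N)%N -> B ^+ N = 0 ->
  symbol N B X (p%:P + 'X * q%:P) = X *m p + B *m X *m q.
Proof.
move=> N0 BN; rewrite /symbol; case: (ltnP 1 N) => N1.
  rewrite -(prednK N0) big_ord_recl expr0 mul1mx.
  rewrite coefD coefXM coefC /= addr0; congr (_ + _).
  have N1' : (0 < N.-1)%N by rewrite -subn1 subn_gt0.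
  rewrite -(prednK N1') big_ord_recl big1 ?addr0 => [|g _].
    by rewrite coefD coefXM !coefC /= add0r expr1.
  by rewrite coefD coefXM !coefC /= addr0 mulmx0.
have N1' : N = 1%N by apply/eqP; rewrite eqn_leq N1.
move: BN; rewrite N1' expr1 => ->; rewrite big_ord1 expr0 mul1mx.
by rewrite coefD coefXM coefC /= addr0 !mul0mx addr0.
Qed.

(** The defect forms of A1 and A2 satisfy
      d(A1 A2) = d(A1) + A1 d(A2) A1^* = d(A2) + A2 d(A1) A2^*,
    and the unitary U relates the two decompositions.  With X (v) the pair made of
    the d(A1) part of v and of the d(A2) part of v A1, it gives
      X (v A1) = (X (v) p2 + X (v B) p1) U^*  and
      X (v A2) = X (v) U p1 + X (v B) U p2,
    so A1 and A2 have symbols of degree one, whose values on the circle are two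
    commuting unitaries with product the variable. *)
Lemma ando_bound n d K (c : {ffun 'I_d -> 'I_K} -> C) kap N (i0 i1 : 'I_d)
    (t : 'I_d -> C) (A1 A2 H : 'M[C]_n.+1) :
  (forall s : 'I_d -> C, (forall j, `|s j| = 1) -> `|mpeval idfun c s| ^+ 2 <= kap) ->
  (forall j, `|t j| = 1) -> (0 < N)%N ->
  H^t* = H -> psd (defect A1 H) -> psd (defect A2 H) ->
  A1 * A2 = A2 * A1 -> (A1 * A2) ^+ N = 0 ->
  forall v, qf H (v *m mpeval (fun x => x%:M) c
    (fun j => if j == i0 then A1 else if j == i1 then A2 else (t j)%:M))
  <= kap * qf H v.
Proof.
move=> hc t1 N0 Hh d1 d2 cA AN; set B := A1 * A2 in AN.
have herm A : (defect A H)^t* = defect A H.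
  by rewrite /defect adjB !adjM trmxCK Hh mulmxA.
have [B1 E1] := psd_factor (herm A1) d1.
have [B2 E2] := psd_factor (herm A2) d2.
pose X := row_mx B1 (A1 *m B2); pose Y := row_mx (A2 *m B1) B2.
have XX : X *m X^t* = defect B H.
  rewrite tr_row_mx map_col_mx mul_row_col -E1 adjM mulmxA -(mulmxA A1) -E2.
  rewrite /defect mulmxBr mulmxBl addrA addrNK /B -mulmxE adjM.
  by rewrite !mulmxA.
have YY : Y *m Y^t* = defect B H.
  rewrite tr_row_mx map_col_mx mul_row_col -E2 adjM mulmxA -(mulmxA A2) -E1.
  rewrite /defect mulmxBr mulmxBl addrC addrA addrNK /B cA -mulmxE adjM.
  by rewrite !mulmxA.
have [|U Uu XU] := @unitary_extension C _ _ X Y; first by rewrite XX YY.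
pose p1 : 'M[C]_(n.+1 + n.+1) := block_mx 1%:M 0 0 0.
pose p2 : 'M[C]_(n.+1 + n.+1) := block_mx 0 0 0 1%:M.
have rp1 (a b : 'M[C]_n.+1) : row_mx a b *m p1 = row_mx a 0.
  by rewrite mul_row_block !mulmx0 mulmx1 !addr0.
have rp2 (a b : 'M[C]_n.+1) : row_mx a b *m p2 = row_mx 0 b.
  by rewrite mul_row_block !mulmx0 mulmx1 !add0r.
have E1X : A1 *m X = X *m (p2 *m U^t*) + B *m X *m (p1 *m U^t*).
  rewrite !mulmxA -mulmxDl -[LHS](mulmxtVK _ Uu); congr (_ *m _).
  rewrite -mulmxA XU -(mulmxA B) rp1 rp2 /Y !mul_mx_row mulmx0 add_row_mx.
  by rewrite addr0 add0r mulmxA.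
have E2X : A2 *m X = X *m (U *m p1) + B *m X *m (U *m p2).
  rewrite !mulmxA -(mulmxA B) XU -(mulmxA B) rp1 rp2 !mul_mx_row mulmx0.
  by rewrite add_row_mx addr0 add0r mulmxA /B cA.
pose m := (n + n.+1)%N.
pose F j : {poly 'M[C]_m.+1} := if j == i0 then
    (p2 *m U^t*)%:P + 'X * (p1 *m U^t*)%:P
  else if j == i1 then (U *m p1)%:P + 'X * (U *m p2)%:P else (t j)%:M%:P.
apply: (@model_bound C n m N B X AN H 1%:M
   _ (mpeval (fun x => x%:M%:P) c F)).
- exact: psd1.
- move=> v; rewrite (telescope_form H v AN); apply: eq_bigr => k _.
  by rewrite -(qf_congr _ X) mulmx1 XX.
- apply: intertwines_mpeval => // j; rewrite /F.
  case: ifP => _; last case: ifP => _; last exact: intertwines_scalar.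
    split; first by rewrite /B -[RHS]mulrA -cA.
    by rewrite symbol_affine.
  split; first by rewrite /B [in LHS]mulrA -cA.
  by rewrite symbol_affine.
move=> z z1 e; rewrite horner_mpeval.
pose V : 'M[C]_m.+1 := (p2 + z *: p1) *m U^t*.
have p1a : p1^t* = p1.
  by rewrite tr_block_mx map_block_mx adj1 !trmx0 !map_mx0.
have p2a : p2^t* = p2.
  by rewrite tr_block_mx map_block_mx adj1 !trmx0 !map_mx0.
have p11 : p1 *m p1 = p1.
  by rewrite mulmx_block !mulmx0 !mul0mx mulmx1 !addr0.
have p22 : p2 *m p2 = p2.
  by rewrite mulmx_block !mulmx0 !mul0mx mulmx1 !add0r.
have p12 : p1 *m p2 = 0.
  by rewrite mulmx_block !mulmx0 !mul0mx !addr0 block_mx0.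
have p21 : p2 *m p1 = 0.
  by rewrite mulmx_block !mulmx0 !mul0mx !addr0 block_mx0.
have p1D : p1 + p2 = 1%:M.
  by rewrite add_block_mx !addr0 add0r -scalar_mx_block.
have zz : z * z^* = 1 by rewrite -normCK z1 expr1n.
have Vu : V \is unitarymx.
  apply: mul_unitarymx; last by rewrite trmxC_unitary.
  apply/unitarymxP; rewrite adjD adjZ p1a p2a mulmxDl !mulmxDr.
  rewrite -!scalemxAl -!scalemxAr p11 p22 p12 p21 !scaler0 addr0 add0r.
  by rewrite scalerA zz scale1r addrC p1D.
have Va : z *: V^t* = U *m p1 + z *: (U *m p2).
  rewrite adjM trmxCK adjD adjZ p1a p2a mulmxDr scalerDr -!scalemxAr scalerA zz.
  by rewrite scale1r addrC.
rewrite (_ : (fun j => _) = fun j => if j == i0 then V else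
    if j == i1 then z *: V^t* else (t j)%:M).
  exact: unitary_mpeval_bound.
have aff (p q : 'M[C]_m.+1) : (p%:P + 'X * q%:P).[z%:M] = p + z *: q.
  by rewrite hornerD hornerC horner_scalarM hornerX hornerC -mulmxE mul_scalar_mx.
apply/funext => j; rewrite /F; case: ifP => _.
  by rewrite aff /V mulmxDl -scalemxAl.
by case: ifP => _; rewrite ?aff ?Va ?hornerC.
Qed.

(** The variables other than the first two are peeled off one by one; d - 1 defect
    operations are needed at most, namely d - 2 for these variables and one more
    to see that each of the two remaining matrices is contractive. *)
Theorem matrix_von_neumann n d K (c : {ffun 'I_d -> 'I_K} -> C) (kap : C) N (r2 : C)
    (A : 'I_d -> 'M[C]_n.+1) (G : 'M[C]_n.+1) :
  (2 <= d)%N -> (0 < N)%N ->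
  (forall s : 'I_d -> C, (forall j, `|s j| = 1) -> `|mpeval idfun c s| ^+ 2 <= kap) ->
  G^t* = G -> psd G -> 0 <= r2 -> (d.-1)%:R * r2 <= 1 ->
  (forall j v, qf G (v *m A j) <= r2 * qf G v) ->
  (forall i j, A i * A j = A j * A i) -> (forall j, A j ^+ N = 0) ->
  forall v, qf G (v *m mpeval (fun x => x%:M) c A) <= kap * qf G v.
Proof.
case: d c A => [|[|d] ] // c A _ N0 hc Gh Gp r0 r1 GA cA AN v.
pose i0 : 'I_d.+2 := ord0; pose i1 : 'I_d.+2 := lift ord0 ord0.
have peels s : uniq s -> i0 \notin s -> i1 \notin s -> (size s <= d)%N ->
  (forall t, (forall j, `|t j| = 1) -> forall e,
    qf (brehmer A G s) (e *m mpeval (fun x => x%:M) c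
      (fun j => if j \in s then (t j)%:M else A j))
    <= kap * qf (brehmer A G s) e) ->
  qf G (v *m mpeval (fun x => x%:M) c A) <= kap * qf G v.
  elim: s => [|i s IHs] /=.
    by move=> _ _ _ _ /(_ (fun=> 1) (fun=> normr1 _) v).
  rewrite !inE !negb_or => /andP[iNs us] /andP[_ i0s] /andP[_ i1s] sd bnd.
  apply: IHs => //; first exact: ltnW.
  move=> t t1; pose Z j : 'M[C]_n.+1 := if j \in s then (t j)%:M else A j.
  have Zi : Z i = A i by rewrite /Z (negPf iNs).
  apply: (@peel n _ K c kap N i Z) => //.
  - move=> j; rewrite Zi /Z; case: ifP => _; last exact: cA.
    by rewrite comm_scalar.
  - by rewrite Zi.
  - rewrite Zi; apply: (@brehmer_psd _ _ A G r2 Gp GA r0 (i :: s)).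
    by apply: le_trans r1; rewrite ler_wpM2r // ler_nat (leq_trans sd).
  - move=> z z1 e; rewrite Zi.
    have := bnd (fun j => if j == i then z else t j) _ e.
    rewrite (_ : (fun j => if j \in i :: s then _ else _) =
      (fun j => if j == i then z%:M else Z j)).
      by apply=> j; case: ifP.
    by apply/funext => j; rewrite inE /Z; case: (j == i).
pose s := [seq j <- enum 'I_d.+2 | (j != i0) && (j != i1)].
have us : uniq s by rewrite filter_uniq ?enum_uniq.
have i0s : i0 \notin s by rewrite mem_filter eqxx.
have i1s : i1 \notin s by rewrite mem_filter eqxx andbF.
have ss : (size s <= d)%N.
  have u2 : uniq (i0 :: i1 :: s) by rewrite /= inE negb_or i0s i1s us.
  have := uniq_leq_size u2 (s2 := enum 'I_d.+2) (fun j _ => mem_enum _ j).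
  by rewrite size_enum_ord.
apply: (peels s) => // t t1 e.
have dr k : (k <= d.+1)%N -> k%:R * r2 <= 1.
  by move=> kd; apply: le_trans r1; rewrite ler_wpM2r // ler_nat.
rewrite (_ : (fun j => _) = fun j => if j == i0 then A i0 else
    if j == i1 then A i1 else (t j)%:M); last first.
  apply/funext => j; rewrite mem_filter mem_enum andbT.
  case: (eqVneq j i0) => [->//|j0]; case: (eqVneq j i1) => [->//|j1].
  by [].
apply: (@ando_bound _ _ K c kap N) => //.
- exact: brehmer_herm.
- by apply: (@brehmer_psd _ _ A G r2 Gp GA r0 (i0 :: s)); rewrite dr.
- by apply: (@brehmer_psd _ _ A G r2 Gp GA r0 (i1 :: s)); rewrite dr.
- by rewrite exprMn_comm ?AN ?mul0r //; apply: cA.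
Qed.

End MatrixVonNeumann.

(** * Real-valued norms and unconditional sums *)

Section RealNorm.
Variable R : realType.
Local Notation C := (Cplx R).

(** Norms of spaces over the complex numbers are complex numbers; the estimates
    below are carried out in the ordered field R. *)
Definition nr (V : normedZmodType C) (x : V) : R := complex.Re `|x|.

Lemma nrE (V : normedZmodType C) (x : V) : `|x| = ((nr x)%:C)%C.
Proof. by rewrite /nr RRe_real // ger0_real. Qed.

Lemma nr_ge0 (V : normedZmodType C) (x : V) : 0 <= nr x.
Proof. by rewrite -ler0c -nrE. Qed.

Lemma nr0 (V : normedZmodType C) : nr (0 : V) = 0.
Proof. by rewrite /nr normr0. Qed.

Lemma nr_eq0 (V : normedZmodType C) (x : V) : nr x = 0 -> x = 0.
Proof. by move=> h; apply/eqP; rewrite -normr_eq0 nrE h. Qed.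

Lemma nrN (V : normedZmodType C) (x : V) : nr (- x) = nr x.
Proof. by rewrite /nr normrN. Qed.

Lemma nrD (V : normedZmodType C) (x y : V) : nr (x + y) <= nr x + nr y.
Proof. by rewrite -lecR rmorphD /= -!nrE ler_normD. Qed.

Lemma nrB (V : normedZmodType C) (x y : V) : nr (x - y) = nr (y - x).
Proof. by rewrite -nrN opprB. Qed.

Lemma nr_tri (V : normedZmodType C) (y x z : V) :
  nr (x - z) <= nr (x - y) + nr (y - z).
Proof. by have := nrD (x - y) (y - z); rewrite addrA addrNK. Qed.

Lemma nr_sum (V : normedZmodType C) (I : Type) (r : seq I) (P : pred I)
    (F : I -> V) :
  nr (\sum_(i <- r | P i) F i) <= \sum_(i <- r | P i) nr (F i).
Proof.
elim/big_rec2: _ => [|i x y _ h]; first by rewrite nr0.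
by apply: le_trans (nrD _ _) _; rewrite lerD2l.
Qed.

Lemma nrM (x y : C) : nr (x * y) = nr x * nr y.
Proof. by apply: complexI; rewrite rmorphM /= -!nrE normrM. Qed.

Lemma nr1 : nr (1 : C) = 1.
Proof. by rewrite /nr normr1. Qed.

Lemma nrX (x : C) n : nr (x ^+ n) = nr x ^+ n.
Proof. by elim: n => [|n IHn]; rewrite ?expr0 ?nr1 // !exprS nrM IHn. Qed.

Lemma nrV (x : C) : nr (x^-1) = (nr x)^-1.
Proof. by apply: complexI; rewrite fmorphV /= -!nrE normfV. Qed.

Lemma nr_prod (I : Type) (r : seq I) (F : I -> C) :
  nr (\prod_(i <- r) F i) = \prod_(i <- r) nr (F i).
Proof. by elim/big_rec2: _ => [|i x y _ <-]; rewrite ?nr1 ?nrM. Qed.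

Lemma nr_real (x : R) : 0 <= x -> nr ((x%:C)%C : C) = x.
Proof. by move=> x0; rewrite /nr ger0_norm ?ler0c. Qed.

Lemma nr_conj (x : R[i]) : nr (x^* : C) = nr (x : C).
Proof. by rewrite /nr norm_conjC. Qed.

Lemma norm_lt_nr (V : normedZmodType C) (x : V) (e : C) : 0 < e ->
  (`|x| < e) = (nr x < complex.Re e).
Proof.
move=> e0; have -> : e = ((complex.Re e)%:C)%C by rewrite RRe_real // gtr0_real.
by rewrite nrE ltcR.
Qed.

Lemma nrZ (V : normedModType C) (a : C) (x : V) : nr (a *: x) = nr a * nr x.
Proof. by apply: complexI; rewrite rmorphM /= -!nrE normrZ. Qed.

Lemma has_sumP (I : choiceType) (V : normedModType C) (u : I -> V) (s : V) :
  has_sum u s <->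
  forall e : R, 0 < e -> exists A0 : {fset I}, forall A : {fset I},
    (A0 `<=` A)%fset -> nr (\sum_(i <- A) u i - s) < e.
Proof.
have FT : Filter (@totally I) by exact: (@filter_filter _ _ (@totally_filter I)).
rewrite /has_sum; split.
  move=> /cvgrPdist_lt h e e0.
  have e0' : (0 : C) < (e%:C)%C by rewrite ltcR.
  have [A0 _ hA0] := h _ e0'; exists A0 => A AA0.
  have := hA0 A AA0; rewrite norm_lt_nr //= /partial_sum big_seq_fsetE /=.
  by rewrite nrB.
move=> h; apply/cvgrPdist_lt => e e0.
have e0' : 0 < complex.Re e.
  by rewrite -ltcR RRe_real ?gtr0_real.
have [A0 hA0] := h _ e0'; exists A0 => // A /= AA0.
by have := hA0 A AA0; rewrite norm_lt_nr // nrB big_seq_fsetE.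
Qed.

End RealNorm.

(** * Multi-indices and geometric tails *)

Section MultiIndex.
Variables (R : realType) (d : nat).
Local Notation C := (Cplx R).
Local Notation idx := (multi_index d).

Definition tdeg (a : idx) : nat := (\sum_j a j)%N.

Definition box_index K (a : {ffun 'I_d -> 'I_K}) : idx := [ffun j => val (a j)].

Definition box K : {fset idx} :=
  seq_fset tt [seq box_index a | a <- enum {ffun 'I_d -> 'I_K}].

Lemma box_index_inj K : injective (@box_index K).
Proof.
by move=> a b /ffunP ab; apply/ffunP => j; have := ab j; rewrite !ffunE => /val_inj.
Qed.

Lemma big_box (V : nmodType) K (F : idx -> V) :
  \sum_(a <- box K) F a = \sum_(a : {ffun 'I_d -> 'I_K}) F (box_index a).
Proof.
have u : uniq [seq box_index a | a <- enum {ffun 'I_d -> 'I_K}].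
  by rewrite map_inj_uniq ?enum_uniq //; apply: box_index_inj.
rewrite (perm_big _ (seq_fset_perm tt _)) /= undup_id // big_map.
by rewrite big_enum.
Qed.

Lemma in_box K a : (a \in box K) = [forall j, (a j < K)%N].
Proof.
rewrite seq_fsetE; apply/mapP/forallP => [[b _ ->] j|h].
  by rewrite ffunE ltn_ord.
exists [ffun j => Ordinal (h j)]; rewrite ?mem_enum //.
by apply/ffunP => j; rewrite !ffunE.
Qed.

Lemma leq_tdeg (a : idx) j : (a j <= tdeg a)%N.
Proof. by rewrite /tdeg (bigD1 j) //= leq_addr. Qed.

(** Both sets are cut out of a box, as exponents are at most the degree.  They are
    locked so that membership is only unfolded by the two lemmas that follow. *)
Definition deg_set k : {fset idx} := locked [fset a in box k.+1 | tdeg a == k]%fset.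
Definition deg_ball n : {fset idx} := locked [fset a in box n | (tdeg a < n)%N]%fset.

Lemma in_deg_set k a : (a \in deg_set k) = (tdeg a == k).
Proof.
rewrite /deg_set -lock !inE /= in_box andbC; case: eqP => //= <-.
by apply/forallP => j; rewrite ltnS leq_tdeg.
Qed.

Lemma in_deg_ball n a : (a \in deg_ball n) = (tdeg a < n)%N.
Proof.
rewrite /deg_ball -lock !inE /= in_box andbC; case: ltnP => //= an.
by apply/forallP => j; apply: leq_ltn_trans an; apply: leq_tdeg.
Qed.

Lemma sum_deg_ball (V : nmodType) n (F : idx -> V) :
  \sum_(a <- deg_ball n) F a = \sum_(k < n) \sum_(a <- deg_set k) F a.
Proof.
have E (k : 'I_n) : \sum_(a <- deg_set k) F a
    = \sum_(a <- deg_ball n | tdeg a == k) F a.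
  rewrite [RHS]big_fset_condE; apply: eq_fbigl => a.
  rewrite in_deg_set !inE /= in_deg_ball; case: eqP => [->|]; rewrite ?andbF //.
  by rewrite ltn_ord.
under [RHS]eq_bigr do rewrite E.
rewrite (exchange_big_dep xpredT) //= big_seq [RHS]big_seq.
apply: eq_bigr => a; rewrite in_deg_ball => an.
by rewrite (big_pred1 (Ordinal an)).
Qed.

Lemma sum_fset_split (V : nmodType) (A B : {fset idx}) (F : idx -> V) :
  (A `<=` B)%fset ->
  \sum_(a <- B) F a = \sum_(a <- A) F a + \sum_(a <- B | a \notin A) F a.
Proof.
move=> AB; rewrite (bigID (fun a => a \in A)) /=; congr (_ + _).
rewrite big_fset_condE; apply: eq_fbigl => a; rewrite !inE /=.
by case: (boolP (a \in A)) => aA; rewrite ?andbF // andbT (fsubsetP AB).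
Qed.

Lemma sum_deg_split (V : nmodType) (A : {fset idx}) n (F : idx -> V) :
  (deg_ball n `<=` A)%fset -> \sum_(a <- A) F a
  = \sum_(a <- deg_ball n) F a + \sum_(a <- A | (n <= tdeg a)%N) F a.
Proof.
move=> /sum_fset_split ->; congr (_ + _).
by apply: eq_bigl => a; rewrite in_deg_ball -leqNgt.
Qed.

Lemma fset_sub_box (A : {fset idx}) : exists K, (A `<=` box K)%fset.
Proof.
exists (\max_(a <- A) tdeg a).+1; apply/fsubsetP => a aA.
rewrite in_box; apply/forallP => j; rewrite ltnS (leq_trans (leq_tdeg a j)) //.
exact: leq_bigmax_seq.
Qed.

Lemma geom_le (x : R) K : 0 <= x < 1 -> \sum_(k < K) x ^+ k <= (1 - x)^-1.
Proof.
move=> /andP[x0 x1]; have y0 : 0 < 1 - x by lra.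
rewrite -[leRHS]mul1r ler_pdivlMr // mulrC.
have := subrX1 x K; have := exprn_ge0 K x0; set S := \sum_(_ < _) _.
nra.
Qed.

(** Every finite set of multi-indices lies in a box, on which the sum is a product
    of d geometric sums. *)
Lemma sum_deg_geom (A : {fset idx}) (x : R) : 0 <= x < 1 ->
  \sum_(a <- A) x ^+ tdeg a <= (1 - x)^-1 ^+ d.
Proof.
move=> x01; have /andP[x0 x1] := x01; have [K AK] := fset_sub_box A.
have -> : (1 - x)^-1 ^+ d = \prod_(j < d) (1 - x)^-1.
  by rewrite prodr_const card_ord.
apply: (@le_trans _ _ (\sum_(a <- box K) x ^+ tdeg a)).
  by rewrite (sum_fset_split _ AK) lerDl sumr_ge0 // => a _; rewrite exprn_ge0.
rewrite big_box.
have -> : \sum_(a : {ffun 'I_d -> 'I_K}) x ^+ tdeg (box_index a)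
   = \prod_(j < d) \sum_(k < K) x ^+ k.
  rewrite bigA_distr_bigA /=; apply: eq_bigr => a _.
  rewrite /tdeg expr_sum; apply: eq_bigr => j _; by rewrite ffunE.
apply: ler_prod => j _; rewrite geom_le // andbT.
by rewrite sumr_ge0 // => k _; rewrite exprn_ge0.
Qed.

(** The ratio is split as y * x: the factor y pays for the smallness of the tail
    and the factor x for its summability. *)
Lemma sum_deg_geom_tail (A : {fset idx}) (x y : R) n :
  0 <= x < 1 -> 0 <= y <= 1 ->
  \sum_(a <- A | (n <= tdeg a)%N) (y * x) ^+ tdeg a <= y ^+ n * (1 - x)^-1 ^+ d.
Proof.
move=> x01 /andP[y0 y1]; have /andP[x0 x1] := x01.
apply: le_trans (ler_wpM2l (exprn_ge0 n y0) (sum_deg_geom A x01)).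
rewrite mulr_sumr big_mkcond; apply: ler_sum => a _ /=.
case: ifP => na; last by rewrite mulr_ge0 ?exprn_ge0.
by rewrite exprMn ler_wpM2r ?exprn_ge0 // ler_wiXn2l.
Qed.

Lemma monomialM (z w : 'I_d -> C) a :
  monomial (fun j => z j * w j) a = monomial z a * monomial w a.
Proof.
by rewrite /monomial -big_split; apply: eq_bigr => j _; rewrite exprMn.
Qed.

Lemma monomial_cst (x : C) a : monomial (fun=> x) a = x ^+ tdeg a.
Proof. by rewrite /monomial /tdeg expr_sum. Qed.

Lemma monomialZ (x : C) (z : 'I_d -> C) a :
  monomial (fun j => x * z j) a = x ^+ tdeg a * monomial z a.
Proof. by rewrite monomialM monomial_cst. Qed.

Lemma nr_monomial_le (z : 'I_d -> C) a (s : R) :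
  (forall j, nr (z j) <= s) -> nr (monomial z a) <= s ^+ tdeg a.
Proof.
move=> zs; rewrite /monomial nr_prod /tdeg expr_sum; apply: ler_prod => j _.
by rewrite nr_ge0 nrX lerXn2r ?nnegrE ?nr_ge0 ?(le_trans (nr_ge0 _) (zs j)).
Qed.

(** A term outside the finite set given by the Cauchy criterion is a difference of
    two partial sums which are both close to the limit. *)
Lemma has_sum_bounded (V : normedModType C) (u : idx -> V) s :
  has_sum u s -> exists K, forall a, nr (u a) <= K.
Proof.
move=> /has_sumP /(_ 1 ltr01)[A0 hA0].
exists (2 + \sum_(a <- A0) nr (u a)) => a.
have S0 : 0 <= \sum_(a <- A0) nr (u a) by rewrite sumr_ge0 // => b _; apply: nr_ge0.
case: (boolP (a \in A0)) => aA.
  rewrite (big_fsetD1 a) //= addrCA lerDl addr_ge0 ?sumr_ge0 // => b _.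
  exact: nr_ge0.
have h0 := hA0 A0 (fsubset_refl _); have h1 := hA0 (a |` A0)%fset (fsubsetU1 _ _).
move: h1; rewrite big_fsetU1 //= => h1.
have := nr_tri s (u a + \sum_(i <- A0) u i) (\sum_(i <- A0) u i).
rewrite addrK [nr (s - _)]nrB; lra.
Qed.

Lemma has_sum_le (V : normedModType C) (u : idx -> V) s x (K : R)
    (B : {fset idx}) :
  has_sum u s ->
  (forall A : {fset idx}, (B `<=` A)%fset -> nr (\sum_(a <- A) u a - x) <= K) ->
  nr (s - x) <= K.
Proof.
move=> /has_sumP h b; apply/ler_addgt0Pr => e e0.
have [A0 hA0] := h e e0; have := hA0 (A0 `|` B)%fset (fsubsetUl _ _).
have := b (A0 `|` B)%fset (fsubsetUr _ _); set S := \sum_(_ <- _) _.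
have := nr_tri S s x; rewrite [nr (s - S)]nrB; lra.
Qed.

Lemma power_series_remainder (c : idx -> C) (v : 'I_d -> C) (s x y K : R) n f :
  (forall a, nr (c a) * s ^+ tdeg a <= K) -> 0 < s -> 0 <= x < 1 -> 0 <= y <= 1 ->
  (forall j, nr (v j) <= s * (y * x)) ->
  has_sum (fun a => c a * monomial v a) f ->
  nr (f - \sum_(a <- deg_ball n) c a * monomial v a)
    <= K * (y ^+ n * (1 - x)^-1 ^+ d).
Proof.
move=> cK s0 x01 y01 vs h; apply: (has_sum_le (B := deg_ball n) h) => A nA.
have /andP[x0 _] := x01; have /andP[y0 _] := y01.
have K0 : 0 <= K.
  by apply: le_trans (cK [ffun=> 0%N]); rewrite mulr_ge0 ?nr_ge0 ?exprn_ge0 // ltW.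
rewrite (sum_deg_split _ nA) addrC addKr.
apply: le_trans (nr_sum _ _ _) _.
apply: le_trans (ler_wpM2l K0 (sum_deg_geom_tail A n x01 y01)).
rewrite mulr_sumr; apply: ler_sum => a _; rewrite nrM.
apply: le_trans (ler_wpM2l (nr_ge0 _) (nr_monomial_le a vs)) _.
by rewrite exprMn mulrA ler_wpM2r ?exprn_ge0 ?mulr_ge0.
Qed.

End MultiIndex.

(** * The maximum principle and the Schwarz lemma *)

Section OneVariable.
Variable R : realType.
Local Notation C := (Cplx R).

(** Taylor approximation at 0: g is p up to a term of order m.  The degree of p is
    not restricted, which makes the notion stable under products. *)
Definition approx (m : nat) (g : C -> C) (p : {poly C}) :=
  exists K e : R, [/\ 0 <= K, 0 < e &
    forall u : C, nr u < e -> nr (g u - p.[u]) <= K * nr u ^+ m].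

(** Order three is what the maximum principle needs; unlike analyticity, it is
    inherited by quotients with an elementary proof. *)
Definition taylor3 (g : C -> C) (w : C) :=
  exists p, approx 3 (fun u => g (w + u)) p.

Lemma poly_bounded (p : {poly C}) :
  exists2 B, 0 <= B & forall u : C, nr u <= 1 -> nr p.[u] <= B.
Proof.
exists (\sum_(i < size p) nr p`_i) => [|u u1].
  by apply: sumr_ge0 => i _; apply: nr_ge0.
rewrite horner_coef; apply: le_trans (nr_sum _ _ _) _; apply: ler_sum => i _.
by rewrite nrM nrX ler_piMr ?nr_ge0 // exprn_ile1 ?nr_ge0.
Qed.

Lemma approx_ext m g h p : (forall u, g u = h u) -> approx m g p -> approx m h p.
Proof. by move=> /funext ->. Qed.

Lemma approxD m g h p q : approx m g p -> approx m h q ->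
  approx m (fun u => g u + h u) (p + q).
Proof.
move=> [K [e [K0 e0 H]]] [K' [e' [K0' e0' H']]].
exists (K + K'), (Num.min e e'); split; rewrite ?addr_ge0 ?lt_min ?e0 //.
move=> u; rewrite lt_min => /andP[ue ue'].
have := nrD (g u - p.[u]) (h u - q.[u]); rewrite hornerD opprD addrACA.
have := H _ ue; have := H' _ ue'; nra.
Qed.

Lemma approxM m g h p q : approx m g p -> approx m h q ->
  approx m (fun u => g u * h u) (p * q).
Proof.
move=> [K [e [K0 e0 H]]] [K' [e' [K0' e0' H']]].
have [B B0 hB] := poly_bounded p; have [B' B0' hB'] := poly_bounded q.
exists (K * (B' + K') + B * K'), (Num.min 1 (Num.min e e')); split.
- by rewrite addr_ge0 ?mulr_ge0 ?addr_ge0.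
- by rewrite !lt_min ltr01 e0.
move=> u; rewrite !lt_min => /and3P[u1 ue ue'].
have -> : g u * h u - (p * q).[u]
   = (g u - p.[u]) * h u + p.[u] * (h u - q.[u]) by rewrite hornerM; ring.
apply: le_trans (nrD _ _) _; rewrite !nrM.
have u1' := ltW u1; have um1 : nr u ^+ m <= 1 by rewrite exprn_ile1 ?nr_ge0.
have hh : nr (h u) <= B' + K'.
  have := nrD (h u - q.[u]) q.[u]; rewrite subrK.
  have := H' _ ue'; have := hB' _ u1'; have := exprn_ge0 m (nr_ge0 u); nra.
have um0 := exprn_ge0 m (nr_ge0 u).
rewrite mulrDl lerD //.
  by rewrite mulrAC ler_pM ?nr_ge0 ?H.
by rewrite -mulrA ler_pM ?nr_ge0 ?H' ?hB.
Qed.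

Lemma approx_poly m (p : {poly C}) : approx m (fun u => p.[u]) p.
Proof.
by exists 0, 1; split=> // u _; rewrite subrr nr0 mul0r.
Qed.

Lemma approx_sum m (I : Type) (r : seq I) (g : I -> C -> C) (p : I -> {poly C}) :
  (forall i, approx m (g i) (p i)) ->
  approx m (fun u => \sum_(i <- r) g i u) (\sum_(i <- r) p i).
Proof.
move=> h; elim: r => [|i r IHr].
  rewrite big_nil; apply: approx_ext (approx_poly m 0) => u.
  by rewrite big_nil horner0.
rewrite big_cons; apply: approx_ext (approxD (h i) IHr) => u.
by rewrite big_cons.
Qed.

(** The error term is exactly - u^3 / (w^3 (w + u)), by the geometric series. *)
Lemma approx_inv (w : C) : w != 0 ->
  approx 3 (fun u => (w + u)^-1)
    (w^-1%:P - w^-1 ^+ 2 *: 'X + w^-1 ^+ 3 *: 'X^2).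
Proof.
move=> w0; have nw0 : 0 < nr w.
  by rewrite lt_def nr_ge0 andbT; apply: contra w0 => /eqP/nr_eq0 ->.
exists ((nr w ^-1) ^+ 3 * (2 / nr w)), (nr w / 2); split.
- by rewrite mulr_ge0 ?exprn_ge0 ?divr_ge0 ?invr_ge0 ?nr_ge0.
- by rewrite divr_gt0.
move=> u uw; have wu : nr w / 2 <= nr (w + u).
  by have := nrD (w + u) (- u); rewrite addrK nrN; lra.
have wu0 : w + u != 0.
  apply/eqP => h; move: wu; rewrite h nr0; lra.
rewrite !(hornerD, hornerN, hornerC, hornerZ, hornerX, hornerXn).
have -> : (w + u)^-1 - (w^-1 - w^-1 ^+ 2 * u + w^-1 ^+ 3 * u ^+ 2)
   = - (w^-1 ^+ 3 * (w + u)^-1 * u ^+ 3) by field; rewrite w0 wu0.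
rewrite nrN nrM [nr (_ * _^-1)]nrM !nrX !nrV ler_wpM2r ?exprn_ge0 ?nr_ge0 //.
rewrite ler_wpM2l ?exprn_ge0 ?invr_ge0 ?nr_ge0 //.
rewrite -[2 / _]invf_div lef_pV2 ?posrE ?divr_gt0 //.
by apply: lt_le_trans wu; rewrite divr_gt0.
Qed.

Lemma approx_value m (g : C -> C) p : (0 < m)%N -> approx m g p -> g 0 = p.[0].
Proof.
case: m => // m _ [K [e [K0 e0 H]]]; apply/eqP; rewrite -subr_eq0.
apply/eqP/nr_eq0/eqP; rewrite eq_le nr_ge0 andbT.
by have := H 0; rewrite nr0 expr0n mulr0; apply.
Qed.

Lemma approx_lipschitz m (g : C -> C) p : (0 < m)%N -> approx m g p ->
  exists K e : R, [/\ 0 <= K, 0 < e &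
    forall u : C, nr u < e -> nr (g u - g 0) <= K * nr u].
Proof.
move=> m0 gp; have g0 := approx_value m0 gp; case: gp => [K [e [K0 e0 H]]].
have /factor_theorem [q Eq] : root (p - p.[0]%:P) 0.
  by rewrite /root !hornerE subrr.
have [B B0 hB] := poly_bounded q.
exists (K + B), (Num.min 1 e); split; rewrite ?addr_ge0 ?lt_min ?ltr01 //.
move=> u; rewrite lt_min => /andP[u1 ue].
have -> : g u - g 0 = (g u - p.[u]) + q.[u] * u.
  have := congr1 (fun p => p.[u]) Eq; rewrite !hornerE subr0 g0 => <-.
  by rewrite addrA subrK.
apply: le_trans (nrD _ _) _; rewrite mulrDl lerD //.
  apply: le_trans (H _ ue) _; rewrite ler_wpM2l //.
  by rewrite -{2}[nr u]expr1 ler_wiXn2l ?nr_ge0 ?ltW.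
by rewrite nrM ler_wpM2r ?nr_ge0 // hB // ltW.
Qed.

Lemma poly_mean (p : {poly R[i]}) M (w : R[i]) (t : R) :
  M.-primitive_root w -> (size p <= M)%N -> 0 <= t ->
  \sum_(l < M) nr (p.[(t%:C)%C * w ^+ l] : C) ^+ 2
  = M%:R * \sum_(k < M) (nr (p`_k : C) * t ^+ k) ^+ 2.
Proof.
move=> pw sp t0.
have nrE2 : forall x : R[i], ((nr (x : C) ^+ 2)%:C)%C = qf 1%:M (x%:M : 'rV_1).
  move=> x; rewrite qf1E big_ord1 mxE eqxx mulr1n rmorphXn /=.
  by rewrite -(nrE (x : C)).
apply: complexI; rewrite rmorphM !rmorph_sum /= rmorph_nat.
have := parseval (1%:M : 'M[R[i]]_1)
  (fun k : 'I_M => ((p`_k * (t%:C)%C ^+ k)%:M : 'rV_1)) pw.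
have -> : \sum_(u < M) qf 1%:M ((p`_u * (t%:C)%C ^+ u)%:M : 'rV_1)
  = \sum_(i < M) (((nr (p`_i : C) * t ^+ i) ^+ 2)%:C)%C.
  apply: eq_bigr => k _; rewrite -nrE2 nrM nrX nr_real //.
move=> <-; apply: eq_bigr => l _; rewrite nrE2; congr qf.
rewrite (horner_coef_wide _ sp).
rewrite (raddf_sum (@scalar_mx R[i] 1)) /=; apply: eq_bigr => k _.
by rewrite scale_scalar_mx exprMn -exprM mulrA mulrC.
Qed.

End OneVariable.

Section MaximumPrinciple.
Variable R : realType.
Local Notation C := (Cplx R).

(** The average of |g|^2 over a small circle is at least |g(w)|^2 - O(t^3), by
    Parseval for the approximating polynomial, while the average of |z|^2 exceeds
    its central value by exactly t^2, which wins for small t. *)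
Lemma no_local_max (g : C -> C) (w : C) (eps e1 : R) : taylor3 g w ->
  0 < eps -> 0 < e1 -> exists u : C, nr u < e1 /\
    nr (g w) ^+ 2 + eps * nr w ^+ 2 < nr (g (w + u)) ^+ 2 + eps * nr (w + u) ^+ 2.
Proof.
move=> [p gp] eps0 e10; have gw := approx_value (isT : (0 < 3)%N) gp.
rewrite addr0 in gw.
case: gp => [K [e [K0 e0 H]]]; have [B B0 hB] := poly_bounded p.
pose M := (size p).+2.
have [om pw] := @closed_prim_root_exists R[i] M isT.
have om1 l : nr (om ^+ l : C) = 1.
  by rewrite /nr normrX (norm_prim_root pw) expr1n.
(* B bounds p on the unit disk and K t^3 the error of g, so the average of |g|^2
   loses at most 2 B K t^3; the radius t makes this smaller than eps t^2. *)
pose D := 1 + 2 * B * K + eps.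
have D0 : 0 < D by rewrite /D; have := mulr_ge0 B0 K0; lra.
pose t := Num.min (Num.min 1 e1) (Num.min e (eps / D)) / 2.
have [t0 t1 te1 te tD] : [/\ 0 < t, t < 1, t < e1, t < e & t < eps / D].
  have q0 : 0 < eps / D by rewrite divr_gt0.
  have : 0 < Num.min (Num.min 1 e1) (Num.min e (eps / D)) by rewrite !lt_min ltr01 e10 e0 q0.
  rewrite /t; set m := Num.min _ _ => m0.
  have : [/\ m <= 1, m <= e1, m <= e & m <= eps / D] by rewrite /m !ge_min !lexx !orbT.
  by case=> *; split; lra.
have tD' : 2 * B * K * t < eps.
  move: tD; rewrite ltr_pdivlMr // /D; have := mulr_ge0 B0 K0; nra.
pose u l : C := (t%:C)%C * om ^+ l.
have nu l : nr (u l) = t by rewrite /u nrM om1 mulr1 nr_real // ltW.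
apply: contrapT => hn.
have le l : nr (g (w + u l)) ^+ 2 + eps * nr (w + u l) ^+ 2
    <= nr (g w) ^+ 2 + eps * nr w ^+ 2.
  rewrite leNgt; apply/negP => hlt; apply: hn; exists (u l); split=> //.
  by rewrite nu.
have S1 : M%:R * nr (g w) ^+ 2 <= \sum_(l < M) nr p.[u l] ^+ 2.
  have sp : (size p <= M)%N by rewrite /M leqW.
  rewrite (poly_mean pw sp (ltW t0)).
  rewrite ler_wpM2l ?ler0n // big_ord_recl expr0 mulr1.
  rewrite gw horner_coef0 lerDl sumr_ge0 // => i _; exact: sqr_ge0.
have S2 : \sum_(l < M) nr (w + u l) ^+ 2 = M%:R * (nr w ^+ 2 + t ^+ 2).
  have -> : \sum_(l < M) nr (w + u l) ^+ 2
     = \sum_(l < M) nr ((w%:P + 'X).[(t%:C)%C * om ^+ l] : C) ^+ 2.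
    by apply: eq_bigr => l _; rewrite hornerD hornerC hornerX.
  have sp : (size (w%:P + 'X)%R <= M)%N by rewrite addrC size_XaddC.
  rewrite (poly_mean pw sp (ltW t0)).
  congr (_ * _); rewrite big_ord_recl big_ord_recl big1 => [|i _].
    by rewrite !coefD !coefC !coefX /= !addr0 !add0r expr0 mulr1 nr1 mul1r expr1.
  by rewrite coefD coefC coefX /= addr0 nr0 mul0r expr0n.
have S3 : \sum_(l < M) nr (g (w + u l)) ^+ 2
    >= \sum_(l < M) nr p.[u l] ^+ 2 - M%:R * (2 * B * (K * t ^+ 3)).
  have -> : M%:R * (2 * B * (K * t ^+ 3)) = \sum_(l < M) (2 * B * (K * t ^+ 3)).
    by rewrite sumr_const card_ord mulr_natl.
  rewrite -sumrB; apply: ler_sum => l _.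
  have h1 : nr (g (w + u l) - p.[u l]) <= K * t ^+ 3 by rewrite -(nu l) H // nu.
  have h2 : nr p.[u l] <= B by rewrite hB // nu ltW.
  have h3 : nr p.[u l] <= nr (g (w + u l)) + nr (g (w + u l) - p.[u l]).
    have := nrD (g (w + u l)) (p.[u l] - g (w + u l)).
    by rewrite addrC subrK [nr (p.[_] - _)]nrB.
  have := nr_ge0 p.[u l]; have := nr_ge0 (g (w + u l)).
  have := nr_ge0 (g (w + u l) - p.[u l]).
  move: h1 h2 h3; set a := nr p.[_]; set b := nr (g _); set c := nr (_ - _).
  set k := K * _ => h1 h2 h3 c0 b0 a0.
  have h4 : a <= b + k by lra.
  have [h5|h5] := leP k a; last by nra.
  have : (a - k) ^+ 2 <= b ^+ 2 by rewrite lerXn2r ?nnegrE; lra.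
  nra.
have S4 : \sum_(l < M) (nr (g (w + u l)) ^+ 2 + eps * nr (w + u l) ^+ 2)
    <= M%:R * (nr (g w) ^+ 2 + eps * nr w ^+ 2).
  have -> : M%:R * (nr (g w) ^+ 2 + eps * nr w ^+ 2)
     = \sum_(l < M) (nr (g w) ^+ 2 + eps * nr w ^+ 2).
    by rewrite sumr_const card_ord mulr_natl.
  by apply: ler_sum => l _; apply: le.
move: S4; rewrite big_split /= -mulr_sumr S2 => S4.
have M0 : (0 : R) < M%:R by rewrite ltr0n.
have : M%:R * (eps * t ^+ 2) <= M%:R * (2 * B * (K * t ^+ 3)) by nra.
rewrite ler_pM2l // => h.
have t2 : 0 < t ^+ 2 by rewrite exprn_gt0.
have : 2 * B * K * t * t ^+ 2 < eps * t ^+ 2 by rewrite ltr_pM2r.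
by move: h; rewrite [t ^+ 3]exprS; lra.
Qed.

End MaximumPrinciple.

Section Schwarz.
Variable R : realType.
Local Notation C := (Cplx R).

Lemma nr_sqE (x y : R) : nr ((x +i* y)%C : C) ^+ 2 = x ^+ 2 + y ^+ 2.
Proof.
apply: complexI; rewrite rmorphXn /= -(nrE ((x +i* y)%C : C)).
by rewrite -add_Re2_Im2.
Qed.

Lemma nr_le_ReIm (x y s : R) : `|x| < s -> `|y| < s -> nr ((x +i* y)%C : C) < 2 * s.
Proof.
move=> xs ys; have s0 : 0 < s by apply: le_lt_trans xs.
rewrite -(ltr_pXn2r (ltn0Sn 1)) ?nnegrE ?nr_ge0 ?mulr_ge0 ?ltW //.
rewrite nr_sqE -(real_normK (num_real x)) -(real_normK (num_real y)).
have := normr_ge0 x; have := normr_ge0 y; nra.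
Qed.

Lemma closed_disk_compact (rho : R) :
  compact [set p : R * R | p.1 ^+ 2 + p.2 ^+ 2 <= rho ^+ 2].
Proof.
apply: (@subclosed_compact _ _ (`[- `|rho|, `|rho|] `*` `[- `|rho|, `|rho|])).
- have -> : [set p : R * R | p.1 ^+ 2 + p.2 ^+ 2 <= rho ^+ 2]
    = (fun p : R * R => p.1 * p.1 + p.2 * p.2) @^-1` [set x | x <= rho ^+ 2].
    by apply/seteqP; split=> p /=; rewrite !expr2.
  apply: preimage_closed; last exact: closed_le.
  move=> p _; apply: cvgD; apply: cvgM;
    by [apply: cvg_fst | apply: cvg_snd].
- by apply: compact_setX; apply: segment_compact.
- move=> [x y] /= h; split; rewrite /= in_itv /= -ler_norml;
    rewrite -(ler_pXn2r (ltn0Sn 1)) ?nnegrE ?normr_ge0 // !real_normK ?num_real //.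
    by apply: le_trans h; rewrite lerDl sqr_ge0.
  by apply: le_trans h; rewrite lerDr sqr_ge0.
Qed.

(** A maximum of |g|^2 + eps |z|^2 on the closed disk exists by compactness and
    must lie on the boundary circle; then eps tends to 0. *)
Lemma max_principle (g : C -> C) (rho M : R) : 0 < rho ->
  (forall w, nr w <= rho -> taylor3 g w) ->
  (forall w, nr w = rho -> nr (g w) <= M) ->
  forall w, nr w <= rho -> nr (g w) <= M.
Proof.
move=> rho0 gT gM w wr.
have M0 : 0 <= M.
  have e : nr ((rho%:C)%C : C) = rho by rewrite nr_real // ltW.
  by apply: le_trans (gM _ e); apply: nr_ge0.
suff h eps : 0 < eps -> nr (g w) ^+ 2 <= M ^+ 2 + eps * rho ^+ 2.
  rewrite -(ler_pXn2r (ltn0Sn 1)) ?nnegrE ?nr_ge0 //.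
  apply/ler_addgt0Pr => e e0.
  have r2 : 0 < rho ^+ 2 by rewrite exprn_gt0.
  have := h (e / rho ^+ 2); rewrite divr_gt0 // => /(_ isT).
  by rewrite divfK ?gt_eqF.
move=> eps0.
pose toC (p : R * R) : C := (p.1 +i* p.2)%C.
have toCr p : (nr (toC p) <= rho) = (p.1 ^+ 2 + p.2 ^+ 2 <= rho ^+ 2).
  by rewrite -nr_sqE ler_pXn2r // nnegrE ?nr_ge0 ?ltW.
pose phi p : R := nr (g (toC p)) ^+ 2 + eps * nr (toC p) ^+ 2.
pose A := [set p : R * R | p.1 ^+ 2 + p.2 ^+ 2 <= rho ^+ 2].
have A0 : A !=set0 by exists (0, 0); rewrite /A /= expr0n addr0 exprn_ge0 ?ltW.
have cphi : {within A, continuous phi}.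
  apply: continuous_in_subspaceT => p; rewrite inE /A /= -toCr => pr.
  have [q gq] := gT _ pr.
  have [K [e [K0 e0 H]]] := approx_lipschitz (isT : (0 < 3)%N) gq.
  rewrite /continuous_at /phi; apply: cvgD.
    apply/cvgrPdist_lt => eta eta0 /=.
    pose b := nr (g (toC p)).
    have b0 : 0 <= b by apply: nr_ge0.
    pose s := Num.min e (Num.min 1 (eta / (K * (2 * b + K) + 1))) / 2.
    have D0 : 0 < K * (2 * b + K) + 1.
      by have := mulr_ge0 K0 b0; nra.
    have [s0 se s1 sD] : [/\ 0 < s, 2 * s <= e, 2 * s <= 1
        & 2 * s <= eta / (K * (2 * b + K) + 1)].
      have q0 : 0 < eta / (K * (2 * b + K) + 1) by rewrite divr_gt0.
      have : 0 < Num.min e (Num.min 1 (eta / (K * (2 * b + K) + 1))).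
        by rewrite !lt_min e0 ltr01 q0.
      rewrite /s; set m := Num.min _ _ => m0.
      have : [/\ m <= e, m <= 1 & m <= eta / (K * (2 * b + K) + 1)].
        by rewrite /m !ge_min !lexx !orbT.
      by case=> *; split; lra.
    rewrite ler_pdivlMr // in sD.
    exists (ball p.1 s, ball p.2 s); first by split; apply: nbhsx_ballx.
    move=> [x y] /= [bx by_].
    pose u : C := ((x - p.1) +i* (y - p.2))%C.
    have us : nr u < 2 * s by apply: nr_le_ReIm; rewrite distrC.
    have -> : toC (x, y) = toC p + u.
      by rewrite /toC /u; apply/eqP; rewrite eq_complex /= !subrKC !eqxx.
    have := H u (lt_le_trans us se); rewrite addr0 => h.
    set a := nr (g (toC p + u)).
    have ab1 : a <= b + K * nr u.
      by have := nrD (g (toC p + u) - g (toC p)) (g (toC p)); rewrite subrK -/a -/b; lra.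
    have ab2 : b <= a + K * nr u.
      have := nrD (g (toC p) - g (toC p + u)) (g (toC p + u)).
      by rewrite subrK nrB -/a -/b; lra.
    have a0 : 0 <= a by apply: nr_ge0.
    have u0 := nr_ge0 u.
    have k1 : K * nr u <= K by rewrite ler_piMr //; lra.
    have k0 : 0 <= K * nr u by rewrite mulr_ge0.
    have k2 : K * nr u * (2 * b + K) < eta.
      have : nr u * (K * (2 * b + K) + 1) < eta.
        by apply: lt_le_trans sD; rewrite ltr_pM2r.
      have := u0; lra.
    set k := K * nr u in ab1 ab2 k1 k0 k2.
    rewrite ltr_norml; apply/andP; split; nra.
  have -> : (fun p : R * R => eps * nr (toC p) ^+ 2)
     = (fun p => eps * (p.1 * p.1 + p.2 * p.2)).
    by apply/funext => q'; rewrite nr_sqE !expr2.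
  rewrite nr_sqE !expr2; apply: cvgM; first exact: cvg_cst.
  by apply: cvgD; apply: cvgM; by [apply: cvg_fst | apply: cvg_snd].
have [p0] := compact_EVT_max A0 (@closed_disk_compact rho) cphi.
rewrite inE => p0A p0max.
have p0r : nr (toC p0) <= rho by rewrite toCr.
have phiw : nr (g w) ^+ 2 + eps * nr w ^+ 2 <= phi p0.
  have -> : w = toC (complex.Re w, complex.Im w) by case: (w).
  apply: p0max; rewrite inE /A.
  have := toCr (complex.Re w, complex.Im w); rewrite /= => <-.
  by case: (w) wr.
have hw : nr (g w) ^+ 2 <= phi p0.
  by apply: le_trans phiw; rewrite lerDl mulr_ge0 ?sqr_ge0 // ltW.
apply: le_trans hw _; have [p0b|p0i] := leP rho (nr (toC p0)).
  have e : nr (toC p0) = rho by apply/eqP; rewrite eq_le p0r p0b.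
  by rewrite /phi e lerD2r lerXn2r ?nnegrE ?nr_ge0 ?gM.
exfalso.
have dr : 0 < rho - nr (toC p0) by rewrite subr_gt0.
have [u [us]] := no_local_max (gT _ p0r) eps0 dr.
apply/negP; rewrite -leNgt.
have -> : toC p0 + u = toC (complex.Re (toC p0 + u), complex.Im (toC p0 + u)).
  by case: (toC p0 + u).
apply: p0max; rewrite inE /A.
have := toCr (complex.Re (toC p0 + u), complex.Im (toC p0 + u)); rewrite /= => <-.
have -> : toC (complex.Re (toC p0 + u), complex.Im (toC p0 + u)) = toC p0 + u.
  by case: (toC p0 + u).
by have := nrD (toC p0) u; lra.
Qed.

Lemma approx_near m (g h : C -> C) p (e : R) : 0 < e ->
  (forall u, nr u < e -> g u = h u) -> approx m g p -> approx m h p.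
Proof.
move=> e0 gh [K [e' [K0 e0' H]]]; exists K, (Num.min e e'); split=> //.
  by rewrite lt_min e0.
by move=> u; rewrite lt_min => /andP[ue ue']; rewrite -gh // H.
Qed.

(** By the inequality of Bernoulli, r^n is at least 1 - n (1 - r), hence tends to 1
    with r. *)
Lemma le_of_lt1_pow (x M a : R) n : 0 <= x -> a < 1 ->
  (forall r, a < r < 1 -> 0 < r -> x * r ^+ n <= M) -> x <= M.
Proof.
move=> x0 a1 h; rewrite leNgt; apply/negP => Mx.
have bern (r : R) : 0 <= r <= 1 -> 1 - n%:R * (1 - r) <= r ^+ n.
  move=> /andP[r0 r1]; elim: n {h} => [|n IHn]; first by rewrite expr0; lra.
  rewrite exprS -natr1; have := exprn_ge0 n r0.
  have : r ^+ n <= 1 by rewrite exprn_ile1.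
  have := ler0n R n; nra.
pose D := 2 * (n%:R * x + 1).
have n0 := ler0n R n.
have D0 : 0 < D by rewrite /D; have := mulr_ge0 n0 x0; lra.
pose s := Num.min (Num.min (1 - a) 1) ((x - M) / D) / 2.
have [s0 sa s1 sD] : [/\ 0 < s, s < 1 - a, s < 1 & s <= (x - M) / D].
  have q0 : 0 < (x - M) / D by rewrite divr_gt0 // subr_gt0.
  have : 0 < Num.min (Num.min (1 - a) 1) ((x - M) / D).
    by rewrite !lt_min subr_gt0 a1 ltr01 q0.
  rewrite /s; set m := Num.min _ _ => m0.
  have : [/\ m <= 1 - a, m <= 1 & m <= (x - M) / D] by rewrite /m !ge_min !lexx !orbT.
  by case=> *; split; lra.
rewrite ler_pdivlMr // /D in sD.
have := h (1 - s); have -> : a < 1 - s < 1 by lra.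
have -> : 0 < 1 - s by lra.
move=> /(_ isT isT); have := bern (1 - s); have -> : 0 <= 1 - s <= 1 by lra.
move=> /(_ isT); have := mulr_ge0 (mulr_ge0 n0 x0) (ltW s0).
set P := (1 - s) ^+ n; nra.
Qed.

(** The quotient of h by the n-th power of the variable is again approximable at
    every point, including 0 where its value is q(0).  The maximum principle on
    the circles of radius r < 1 bounds it by M / r^n, and r tends to 1. *)
Lemma schwarz (h : C -> C) (q : {poly C}) n (M : R) :
  (forall w, nr w < 1 -> taylor3 h w) ->
  (forall w, nr w < 1 -> nr (h w) <= M) ->
  approx (n + 3) h ('X^n * q) ->
  (forall w, nr w < 1 -> nr (h w) <= M * nr w ^+ n) /\ nr q.[0] <= M.
Proof.
move=> hT hM hq.
have nr_gt0 (w : C) : w != 0 -> 0 < nr w.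
  by move=> w0; rewrite lt_def nr_ge0 andbT; apply: contra w0 => /eqP/nr_eq0 ->.
pose g (w : C) : C := if w == 0 then q.[0] else h w * (w^-1) ^+ n.
have gT w : nr w < 1 -> taylor3 g w.
  move=> w1; have [->|w0] := eqVneq w 0.
    exists q; have [K [e [K0 e0 H]]] := hq; exists K, e; split=> // u ue.
    rewrite add0r /g; case: eqVneq => [->|u0].
      by rewrite subrr nr0 mulr_ge0 ?exprn_ge0 ?nr_ge0.
    have -> : h u * u^-1 ^+ n - q.[u] = (h u - ('X^n * q).[u]) * u^-1 ^+ n.
      rewrite hornerM hornerXn mulrBl; congr (_ - _).
      by rewrite mulrAC -exprMn divff // expr1n mul1r.
    rewrite nrM nrX nrV exprVn ler_pdivrMr ?exprn_gt0 ?nr_gt0 //.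
    by rewrite -mulrA -exprD addnC H.
  have [p hp] := hT w w1; have ip := approx_inv w0.
  have ipn k : exists r, approx 3 (fun u => ((w + u)^-1) ^+ k) r.
    elim: k => [|k [r hr]]; first exists 1%:P.
      by apply: approx_ext (approx_poly 3 1%:P) => u; rewrite expr0 hornerC.
    eexists; apply: approx_ext (approxM ip hr) => u; by rewrite exprS.
  have [r hr] := ipn n; exists (p * r).
  apply: approx_near (nr_gt0 _ w0) _ (approxM hp hr) => u uw.
  rewrite /g; case: eqVneq => // wu; exfalso.
  move: uw; have -> : u = - w by apply/eqP; rewrite -addr_eq0 addrC wu.
  by rewrite nrN ltxx.
have gb w : nr w < 1 -> nr (g w) <= M.
  move=> w1; apply: (@le_of_lt1_pow _ _ (nr w) n (nr_ge0 _) w1) => r /andP[wr r1] r0.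
  rewrite -ler_pdivlMr ?exprn_gt0 //.
  apply: (@max_principle g r _ r0 _ _ w (ltW wr)) => z zr.
    by apply: gT; apply: le_lt_trans zr r1.
  have z0 : z != 0 by apply/eqP => z0; move: r0; rewrite -zr z0 nr0 ltxx.
  rewrite /g (negPf z0) nrM nrX nrV zr exprVn.
  apply: ler_wpM2r; first by rewrite invr_ge0 exprn_ge0 // ltW.
  by apply: hM; rewrite zr.
split=> [w w1|]; last first.
  by have := gb 0; rewrite /g eqxx nr0; apply; apply: ltr01.
have := gb w w1; rewrite /g; case: eqVneq => [->|w0].
  move=> q0; have := approx_value _ hq; rewrite addnS => /(_ isT) ->.
  rewrite hornerM hornerXn nrM nrX mulrC ler_wpM2r ?exprn_ge0 ?nr_ge0 //.
by rewrite nrM nrX nrV exprVn ler_pdivrMr ?exprn_gt0 ?nr_gt0.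
Qed.

End Schwarz.

(** * Power series of Schur functions *)

Section Expansion.
Variables (R : realType) (d : nat).
Local Notation C := (Cplx R).
Local Notation idx := (multi_index d).

(** Since the powers of y decrease, n y^n is at most the sum of the geometric
    series, which gives an explicit n by the archimedean property. *)
Lemma geometric_small (y B e : R) : 0 <= y < 1 -> 0 < e -> exists n, B * y ^+ n < e.
Proof.
move=> y01 e0; have /andP[y0 y1] := y01.
pose B' := Num.max B 1; have B0 : 0 < B' by rewrite lt_max ltr01 orbT.
have y1' : 0 < 1 - y by lra.
pose x := B' / ((1 - y) * e).
have x0 : 0 <= x by rewrite divr_ge0 ?mulr_ge0 ?ltW.
exists (Num.bound x); have := archi_boundP x0; set n := Num.bound x => xn.
have h : n.+1%:R * y ^+ n <= (1 - y)^-1.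
  apply: le_trans (geom_le n.+1 y01).
  rewrite mulr_natl -[X in _ *+ X]card_ord -sumr_const; apply: ler_sum => k _.
  by rewrite ler_wiXn2l ?(ltW y1) // -ltnS.
have yn := exprn_ge0 n y0.
have Bn : B * y ^+ n <= B' * y ^+ n by rewrite ler_wpM2r // le_max lexx.
apply: le_lt_trans Bn _.
move: xn; rewrite /x ltr_pdivrMr ?mulr_gt0 // => xn.
have h' : n.+1%:R * y ^+ n * (1 - y) <= 1 by rewrite -ler_pdivlMr // div1r.
rewrite -natr1 in h'.
have [->|ynz] := eqVneq (y ^+ n) 0; first by rewrite mulr0.
have yp : 0 < y ^+ n by rewrite lt_def ynz.
have : B' * y ^+ n < n%:R * ((1 - y) * e) * y ^+ n by rewrite ltr_pM2r.
have : 0 <= y ^+ n * (1 - y) by rewrite mulr_ge0 // ltW.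
nra.
Qed.

Definition homog_part (c : idx -> C) k (z : 'I_d -> C) : C :=
  \sum_(a <- deg_set d k) c a * monomial z a.

(** The Taylor polynomial at 0 of the slice u |-> f (u z). *)
Definition slice_poly (c : idx -> C) n (z : 'I_d -> C) : {poly C} :=
  \sum_(k < n) homog_part c k z *: 'X^k.

Lemma homog_partZ c k (x : C) z :
  homog_part c k (fun j => x * z j) = x ^+ k * homog_part c k z.
Proof.
rewrite /homog_part mulr_sumr big_seq [RHS]big_seq; apply: eq_bigr => a.
by rewrite in_deg_set => /eqP <-; rewrite monomialZ mulrCA.
Qed.

Lemma horner_slice_poly c n z (u : C) :
  (slice_poly c n z).[u] = \sum_(a <- deg_ball d n) c a * monomial (fun j => u * z j) a.
Proof.
rewrite sum_deg_ball /slice_poly horner_sum; apply: eq_bigr => k _.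
by rewrite hornerZ hornerXn mulrC -homog_partZ.
Qed.

(** The series converges at the point w + (s, ..., s) with s half of the radius e,
    so its terms are bounded there; hence it has a geometric tail near w, uniformly
    in the direction z of the slice. *)
Lemma slice_approx (f : ('I_d -> C) -> C) (w z : 'I_d -> C) (e : C) c n :
  0 < e ->
  (forall x, (forall j, `|x j - w j| < e) -> has_power_series_at f w c x) ->
  (forall j, nr (z j) <= 1) ->
  approx n (fun u => f (fun j => w j + u * z j)) (slice_poly c n z).
Proof.
move=> e0 h z1; set E := complex.Re e.
have E0 : 0 < E by rewrite -ltcR RRe_real ?gtr0_real.
pose s := E / 2; have s0 : 0 < s by rewrite divr_gt0.
have sE : s < E by rewrite /s; lra.
have ns : nr ((s%:C)%C : C) = s by rewrite nr_real // ltW.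
have [K hK] : exists K, forall a, nr (c a) * s ^+ tdeg a <= K.
  have [|K hK] := has_sum_bounded (h (fun j => w j + (s%:C)%C) _).
    by move=> j; rewrite norm_lt_nr // addrC addKr ns.
  exists K => a; have := hK a; rewrite nrM.
  suff -> : monomial (fun j => w j + (s%:C)%C - w j) a = ((s%:C)%C : C) ^+ tdeg a.
    by rewrite nrX ns.
  by rewrite -monomial_cst; congr monomial; apply/funext => j; rewrite addrC addKr.
have K0 : 0 <= K.
  by apply: le_trans (hK [ffun=> 0%N]); rewrite mulr_ge0 ?nr_ge0 ?exprn_ge0 // ltW.
exists (K * ((2 / s) ^+ n * (1 - 2^-1)^-1 ^+ d)), (s / 2); split.
- have : (0 : R) <= (1 - 2^-1)^-1 by rewrite invr_ge0; lra.
  move=> q0; apply: mulr_ge0 => //; apply: mulr_ge0; apply: exprn_ge0 => //.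
  by rewrite divr_ge0 // ltW.
- by rewrite divr_gt0.
move=> u us; rewrite horner_slice_poly.
have uz j : nr (u * z j) <= nr u by rewrite nrM ler_piMr ?nr_ge0.
have us' : 2 * nr u / s <= 1 by rewrite ler_pdivrMr // mul1r; lra.
have us0 : 0 <= 2 * nr u / s by rewrite !mulr_ge0 ?nr_ge0 ?invr_ge0 // ltW.
have vs j : nr (u * z j) <= s * (2 * nr u / s * 2^-1).
  apply: le_trans (uz j) _; rewrite le_eqVlt; apply/orP; left; apply/eqP.
  by field; rewrite gt_eqF.
have hsum : has_sum (fun a => c a * monomial (fun j => u * z j) a)
    (f (fun j => w j + u * z j)).
  rewrite (_ : (fun j => u * z j) = fun j => w j + u * z j - w j).
    apply: h => j; rewrite norm_lt_nr // addrC addKr.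
    by apply: le_lt_trans (uz j) _; apply: lt_trans us _; rewrite -/E; lra.
  by apply/funext => j; rewrite addrC addKr.
have x01 : 0 <= (2^-1 : R) < 1 by apply/andP; split; lra.
have y01 : 0 <= 2 * nr u / s <= 1 by rewrite us0.
have := power_series_remainder n hK s0 x01 y01 vs hsum.
have -> // : K * ((2 * nr u / s) ^+ n * (1 - 2^-1)^-1 ^+ d)
  = K * ((2 / s) ^+ n * (1 - 2^-1)^-1 ^+ d) * nr u ^+ n.
by rewrite [2 * nr u / s]mulrAC exprMn; set q := (1 - _)^-1; ring.
Qed.

(** The pair made of a primitive root of unity and its conjugate, stated over the
    normed field so that it combines with the coefficients of f. *)
Lemma dual_roots M : (0 < M)%N -> exists w wb : C,
  [/\ nr w = 1, nr wb = 1 & forall u v, (u < M)%N -> (v < M)%N ->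
   \sum_(l < M) w ^+ (l * u) * wb ^+ (l * v) = if u == v then M%:R else 0].
Proof.
move=> M0; have [om pw] := closed_prim_root_exists R[i] M0.
have n1 : nr (om : C) = 1 by rewrite /nr (norm_prim_root pw).
exists om, (om^*); split=> //; first by rewrite nr_conj.
move=> u v uM vM; have := root_orthogonality pw uM vM.
by under eq_bigr do rewrite rmorphXn.
Qed.

Section Coefficients.
Variables (f : ('I_d -> C) -> C) (c : idx -> C) (e : C).
Hypothesis f_an : analytic_on_polydisk f.
Hypothesis f_le1 : forall z, polydisk z -> `|f z| <= 1.
Hypothesis e0 : 0 < e.
Hypothesis fc : forall z, (forall j, `|z j - 0| < e) ->
  has_power_series_at f (fun=> 0) c z.

Lemma polydisk_slice (z : 'I_d -> C) (w : C) :
  (forall j, nr (z j) <= 1) -> nr w < 1 -> polydisk (fun j => w * z j).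
Proof.
move=> z1 w1 j; rewrite norm_lt_nr ?ltr01 // nrM.
by apply: le_lt_trans w1; rewrite ler_piMr ?nr_ge0.
Qed.

Lemma nr_f z : polydisk z -> nr (f z) <= 1.
Proof. by move=> /f_le1; rewrite nrE -[X in _ <= X -> _]/((1%:C)%C) lecR. Qed.

Lemma slice_taylor (z : 'I_d -> C) (w : C) :
  (forall j, nr (z j) <= 1) -> nr w < 1 -> taylor3 (fun u => f (fun j => u * z j)) w.
Proof.
move=> z1 w1; have [e' [c' [e'0 h]]] := f_an (polydisk_slice z1 w1).
exists (slice_poly c' 3 z); apply: approx_ext (slice_approx 3 e'0 h z1) => u.
by congr f; apply/funext => j; rewrite mulrDl.
Qed.

Lemma slice_approx0 n (z : 'I_d -> C) : (forall j, nr (z j) <= 1) ->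
  approx n (fun u => f (fun j => u * z j)) (slice_poly c n z).
Proof.
move=> z1; apply: approx_ext (slice_approx n e0 fc z1) => u.
by congr f; apply/funext => j; rewrite add0r.
Qed.

(** Averaging u |-> f (u z) against a character of the group of M-th roots of
    unity kills every homogeneous part of degree less than M = k + 3 but the k-th.
    The average is bounded by 1 and vanishes to order k at 0, so the Schwarz lemma
    bounds its leading coefficient. *)
Lemma homog_part_le1 k (z : 'I_d -> C) : (forall j, nr (z j) <= 1) ->
  nr (homog_part c k z) <= 1.
Proof.
move=> z1; pose M := (k + 3)%N.
have M0 : (0 < M)%N by rewrite /M addnS.
have [om [ob [n1 nb1 orth]]] := dual_roots M0.
have om1 l : nr (om ^+ l) = 1 by rewrite nrX n1 expr1n.
have ob1 l : nr (ob ^+ l) = 1 by rewrite nrX nb1 expr1n.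
have zl l j : nr (om ^+ l * z j) <= 1 by rewrite nrM om1 mul1r.
pose h (u : C) : C := \sum_(l < M) (M%:R^-1 * ob ^+ (l * k))
   * f (fun j => u * (om ^+ l * z j)).
have hp : approx M h ('X^k * (homog_part c k z)%:P).
  have -> : 'X^k * (homog_part c k z)%:P = \sum_(l < M)
      (M%:R^-1 * ob ^+ (l * k))%:P * slice_poly c M (fun j => om ^+ l * z j).
    transitivity (\sum_(m < M) \sum_(l < M)
       ((M%:R^-1 * ob ^+ (l * k)) * (om ^+ (l * m) * homog_part c m z)) *: 'X^m : {poly C}).
      have kM : (k < M)%N by rewrite /M addnS ltnS leq_addr.
      rewrite (bigD1 (Ordinal kM)) //= [X in _ = _ + X]big1 ?addr0 => [|m mk].
        rewrite -scaler_suml -mul_polyC mulrC; congr (_%:P * _).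
        transitivity (M%:R^-1 * (\sum_(l < M) om ^+ (l * k) * ob ^+ (l * k)) * homog_part c k z).
          by rewrite orth // eqxx mulVf ?mul1r // pnatr_eq0 -lt0n.
        by rewrite [M%:R^-1 * _]mulr_sumr mulr_suml; apply: eq_bigr => l _; ring.
      rewrite -scaler_suml (_ : \sum_(l < M) _ = 0) ?scale0r //.
      transitivity (M%:R^-1 * (\sum_(l < M) om ^+ (l * m) * ob ^+ (l * k)) * homog_part c m z).
        by rewrite [M%:R^-1 * _]mulr_sumr mulr_suml; apply: eq_bigr => l _; ring.
      rewrite orth //.
      by rewrite -val_eqE /= in mk; rewrite (negPf mk) mulr0 mul0r.
    rewrite exchange_big /=; apply: eq_bigr => l _.
    rewrite /slice_poly mulr_sumr; apply: eq_bigr => m _.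
    by rewrite homog_partZ -exprM mul_polyC scalerA.
  apply: approx_sum => l; apply: approxM; last exact: slice_approx0.
  apply: approx_ext (approx_poly M _) => u; exact: hornerC.
have hT w : nr w < 1 -> taylor3 h w.
  move=> w1; rewrite /taylor3.
  have hl l : exists p, approx 3 (fun u => f (fun j => (w + u) * (om ^+ l * z j))) p.
    exact: (slice_taylor (zl l) w1).
  have [p hp'] := choice hl.
  exists (\sum_(l < M) (M%:R^-1 * ob ^+ (l * k))%:P * p l).
  apply: approx_sum => l; apply: approxM; last exact: hp'.
  apply: approx_ext (approx_poly 3 _) => u; exact: hornerC.
have hM w : nr w < 1 -> nr (h w) <= 1.
  move=> w1; apply: le_trans (nr_sum _ _ _) _.
  apply: (@le_trans _ _ (\sum_(l < M) M%:R^-1)); last first.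
    by rewrite sumr_const card_ord -[_^-1 *+ _]mulr_natl divff // pnatr_eq0 -lt0n.
  apply: ler_sum => l _; rewrite nrM nrM nrV ob1 mulr1.
  have -> : nr (M%:R : C) = M%:R by rewrite /nr normr_nat -(rmorph_nat (real_complex R)).
  by rewrite ler_piMr ?invr_ge0 // nr_f //; apply: polydisk_slice.
by have [_] := schwarz hT hM hp; rewrite hornerC.
Qed.

(** Removing the first n terms of the slice leaves a function vanishing to order n
    at 0 and bounded by 1 + n; the Schwarz lemma makes it small inside the disk,
    without any analytic continuation of the local expansion. *)
Lemma slice_remainder n (z : 'I_d -> C) (w : C) : (forall j, nr (z j) <= 1) ->
  nr w < 1 ->
  nr (f (fun j => w * z j) - (slice_poly c n z).[w]) <= (1 + n%:R) * nr w ^+ n.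
Proof.
move=> z1 w1.
pose h u : C := f (fun j => u * z j) + (- slice_poly c n z).[u].
pose q : {poly C} := \sum_(i < 3) homog_part c (n + i) z *: 'X^i.
have hp : approx (n + 3) h ('X^n * q).
  have -> : 'X^n * q = slice_poly c (n + 3) z - slice_poly c n z.
    rewrite /slice_poly big_split_ord /= [RHS]addrC addKr mulr_sumr.
    by apply: eq_bigr => i _; rewrite -scalerAr exprD.
  by apply: approxD; [exact: slice_approx0 | exact: approx_poly].
have hT x : nr x < 1 -> taylor3 h x.
  move=> x1; have [p hp'] := slice_taylor z1 x1.
  exists (p + ((- slice_poly c n z) \Po (x%:P + 'X))); apply: (approxD hp').
  apply: approx_ext (approx_poly 3 _) => u.
  by rewrite horner_comp hornerD hornerC hornerX.
have hM x : nr x < 1 -> nr (h x) <= 1 + n%:R.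
  move=> x1; apply: le_trans (nrD _ _) _; rewrite lerD ?nr_f //.
    exact: polydisk_slice.
  rewrite hornerN nrN /slice_poly horner_sum; apply: le_trans (nr_sum _ _ _) _.
  rewrite -[n in n%:R]card_ord -sumr_const; apply: ler_sum => k _.
  rewrite hornerZ hornerXn nrM nrX -[X in _ <= X]mulr1 ler_pM ?exprn_ge0 ?nr_ge0 //.
    exact: homog_part_le1.
  by rewrite exprn_ile1 ?nr_ge0 ?ltW.
have [H _] := schwarz hT hM hp; by have := H w w1; rewrite /h hornerN.
Qed.

(** A coefficient is recovered from the homogeneous part of its degree by averaging
    over a finite subgroup of the torus. *)
Lemma coef_le1 b : nr (c b) <= 1.
Proof.
pose k := tdeg b; pose M := k.+1.
have [om [ob [n1 nb1 orthM]]] := dual_roots (ltn0Sn k).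
have om1 l : nr (om ^+ l) = 1 by rewrite nrX n1 expr1n.
have ob1 l : nr (ob ^+ l) = 1 by rewrite nrX nb1 expr1n.
pose z (l : {ffun 'I_d -> 'I_M}) : 'I_d -> C := fun j => om ^+ l j.
pose cz (l : {ffun 'I_d -> 'I_M}) : C := \prod_j ob ^+ (l j * b j).
have orth a : tdeg a = k -> \sum_l monomial (z l) a * cz l
   = if a == b then (M%:R ^+ d : C) else 0.
  move=> ak.
  transitivity (\prod_(j < d) \sum_(l < M)
      (om ^+ (l * a j) * ob ^+ (l * b j))).
    rewrite bigA_distr_bigA /=; apply: eq_bigr => l _.
    rewrite /monomial /cz -big_split; apply: eq_bigr => j _.
    by rewrite /z -exprM.
  have bd (a' : idx) j : tdeg a' = k -> (a' j < M)%N.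
    by move=> ak'; rewrite /M -ak' ltnS leq_tdeg.
  case: eqVneq => [->|ab].
    transitivity (\prod_(j < d) (M%:R : C)); last by rewrite prodr_const card_ord.
    by apply: eq_bigr => j _; rewrite orthM ?bd // eqxx.
  have [j abj] : exists j, a j != b j.
    apply/existsP; rewrite -negb_forall; apply: contra ab => /forallP h.
    by apply/eqP/ffunP => j; apply/eqP.
  rewrite (bigD1 j) //= orthM ?bd //.
  by rewrite (negPf abj) mul0r.
have E : \sum_l homog_part c k (z l) * cz l = c b * M%:R ^+ d.
  rewrite /homog_part; under eq_bigr do rewrite mulr_suml.
  rewrite exchange_big /= (big_fsetD1 b) ?in_deg_set //=.
  rewrite [X in _ + X]big_seq [X in _ + X]big1 ?addr0 => [|a].
    have := orth b erefl; rewrite eqxx => <-.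
    by rewrite mulr_sumr; apply: eq_bigr => l _; rewrite mulrA.
  rewrite in_fsetD1 in_deg_set => /andP[ab /eqP ak].
  transitivity (c a * \sum_l monomial (z l) a * cz l).
    by rewrite mulr_sumr; apply: eq_bigr => l _; rewrite mulrA.
  by rewrite orth // (negPf ab) mulr0.
have M0 : (0 : R) < M%:R ^+ d by rewrite exprn_gt0 // ltr0n.
have nM : nr (M%:R ^+ d : C) = M%:R ^+ d.
  by rewrite nrX /nr normr_nat -(rmorph_nat (real_complex R)).
rewrite -(ler_pM2r M0) mul1r -{1}nM -nrM -E.
apply: le_trans (nr_sum _ _ _) _.
have -> : (M%:R ^+ d : R) = \sum_(l : {ffun 'I_d -> 'I_M}) 1.
  by rewrite sumr_const card_ffun !card_ord natrX.
apply: ler_sum => l _; rewrite nrM.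
have -> : nr (cz l) = 1.
  by rewrite /cz nr_prod big1 // => j _; rewrite ob1.
by rewrite mulr1 homog_part_le1 // => j; rewrite /z om1.
Qed.

(** The point is written s z' with s < 1 and z' in the closed polydisk.  The head of
    the series is controlled along the slice of z', the tail by the bound on the
    coefficients. *)
Lemma global_power_series z : polydisk z -> has_power_series_at f (fun=> 0) c z.
Proof.
move=> zD.
have [s [s0 s1 zs]] : exists s : R, [/\ 0 < s, s < 1 & forall j, nr (z j) <= s].
  have z1 j : nr (z j) < 1 by have := zD j; rewrite norm_lt_nr ?ltr01.
  exists (\big[Num.max/2^-1]_j nr (z j)); split.
  - by apply: lt_le_trans (bigmax_ge_id _ _ _ _); rewrite invr_gt0.
  - by apply/bigmax_ltP; split=> [|j _]; rewrite ?invf_lt1 ?ltr1n.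
  - by move=> j; apply: le_bigmax.
have sn0 : (s%:C)%C != 0 :> C by rewrite -[0]/((0%:C)%C) (inj_eq (@complexI _)) gt_eqF.
have ns : nr ((s%:C)%C : C) = s by rewrite nr_real // ltW.
pose z' j : C := (s%:C)%C^-1 * z j.
have z'1 j : nr (z' j) <= 1 by rewrite nrM nrV ns mulrC ler_pdivrMr // mul1r.
have zz' : z = fun j => (s%:C)%C * z' j.
  by apply/funext => j; rewrite /z' mulrA divff // mul1r.
pose x := (1 + s) / 2; pose y := s / x.
have x0 : 0 < x by rewrite /x; lra.
have x01 : 0 <= x < 1 by rewrite ltW //= /x; lra.
have y0 : 0 <= y by rewrite divr_ge0 // ltW.
have y1 : y < 1 by rewrite ltr_pdivrMr // mul1r /x; lra.
have yx : s = y * x by rewrite divfK ?gt_eqF.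
have ix : 0 < (1 - x)^-1 by rewrite invr_gt0 subr_gt0; case/andP: x01.
apply/has_sumP => eps eps0.
have [|n hn] := @geometric_small y ((1 - x)^-1 + (1 - x)^-1 ^+ d) eps _ eps0.
  by rewrite y0.
exists (deg_ball d n) => A nA.
rewrite (_ : (fun j => z j - 0) = z); last by apply/funext => j; rewrite subr0.
rewrite (sum_deg_split _ nA).
have tail : nr (\sum_(a <- A | (n <= tdeg a)%N) c a * monomial z a)
    <= y ^+ n * (1 - x)^-1 ^+ d.
  apply: le_trans (nr_sum _ _ _) _.
  apply: le_trans (@sum_deg_geom_tail _ _ A x y n x01 _); last by rewrite y0 ltW.
  apply: ler_sum => a _; rewrite nrM -[leRHS]mul1r ler_pM ?nr_ge0 ?coef_le1 //.
  by rewrite -yx; apply: nr_monomial_le.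
have head : nr (f z - \sum_(a <- deg_ball d n) c a * monomial z a)
    <= y ^+ n * (1 - x)^-1.
  have := @slice_remainder n z' (s%:C)%C z'1; rewrite ns horner_slice_poly -zz'.
  move=> /(_ s1) /le_trans; apply; rewrite {1}yx exprMn mulrCA.
  apply: ler_wpM2l; first exact: exprn_ge0.
  apply: le_trans (geom_le n.+1 x01).
  rewrite [1 + _]addrC natr1 mulr_natl -[X in _ *+ X]card_ord -sumr_const.
  apply: ler_sum => k _; have /andP[? ?] := x01.
  by rewrite ler_wiXn2l ?ltW // -ltnS.
set S := \sum_(a <- deg_ball d n) _ in head *.
set T := \sum_(a <- A | _) _ in tail *.
have := nrD (S - f z) T; rewrite addrAC [nr (S - _)]nrB => h.
apply: le_lt_trans hn; apply: le_trans h _; lra.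
Qed.

End Coefficients.

Theorem schur_expansion (f : ('I_d -> C) -> C) : schur_class f ->
  exists c : idx -> C, (forall a, nr (c a) <= 1) /\
    forall z, polydisk z -> has_power_series_at f (fun=> 0) c z.
Proof.
move=> [f_an f1]; have [|e [c [e0 h]]] := f_an (fun=> 0).
  by move=> j; rewrite normr0 ltr01.
exists c; split=> [a|z zD]; first exact: coef_le1 e0 h a.
exact: global_power_series e0 h z zD.
Qed.

End Expansion.

(** * From Hilbert space operators to nilpotent matrices *)

Section Krylov.
Variables (R : realType) (d : nat).
Local Notation C := (Cplx R).
Local Notation idx := (multi_index d).

Lemma op_monomial0 (H : normedModType C) (T : 'I_d -> {linear H -> H}) x :
  op_monomial T [ffun=> 0%N] x = x.
Proof.
rewrite /op_monomial; elim: (index_enum _) => [|j r IHr]; first by rewrite big_nil.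
by rewrite big_cons ffunE /= IHr.
Qed.

Definition incr (j : 'I_d) (a : idx) : idx := [ffun i => (a i + (i == j))%N].

Lemma tdeg_incr j a : tdeg (incr j a) = (tdeg a).+1.
Proof.
rewrite /tdeg (eq_bigr (fun i => a i + (i == j))%N) => [|i _]; last by rewrite ffunE.
rewrite big_split /= -addn1; congr (_ + _)%N.
by rewrite (bigD1 j) //= eqxx big1 // => i /negPf->.
Qed.

(** By commutation a further factor T_j can be moved to the place where the
    composition already has its power of T_j. *)
Lemma op_monomial_incr (H : normedModType C) (T : 'I_d -> {linear H -> H}) :
  (forall i j x, T i (T j x) = T j (T i x)) ->
  forall j a x, op_monomial T (incr j a) x = T j (op_monomial T a x).
Proof.
move=> cT j a x; rewrite /op_monomial.
have cit i k y : iter k (T i) (T j y) = T j (iter k (T i) y).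
  by elim: k => //= k ->.
suff gen r : uniq r ->
    (\big[(fun g h : H -> H => g \o h)/id]_(i <- r) iter (incr j a i) (T i)) x
    = (if j \in r then T j else idfun)
       ((\big[(fun g h : H -> H => g \o h)/id]_(i <- r) iter (a i) (T i)) x).
  by rewrite gen ?index_enum_uniq // mem_index_enum.
elim: r => [|i r IHr] /=; first by rewrite !big_nil.
move=> /andP[ir ur]; rewrite !big_cons /= IHr // inE ffunE [j == i]eq_sym.
case: eqVneq ir => [->|ij] ir /=; first by rewrite (negPf ir) addn1.
by rewrite addn0; case: ifP.
Qed.

Section Hilbert.
Variables (H : completeNormedModType C) (ip : {dot H for (@Num.conj R[i])}).
Hypothesis Hip : is_hilbert ip.

Lemma ip_sum (I : finType) (v : I -> C) (y : I -> H) :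
  ip (\sum_i v i *: y i) (\sum_i v i *: y i)
  = \sum_i \sum_j v i * (v j : R[i])^* * ip (y i) (y j).
Proof.
rewrite linear_sumlz /=; apply: eq_bigr => i _.
rewrite linear_sumr /=; apply: eq_bigr => j _.
by rewrite linearZl_LR linearZr_LR /= mulrA.
Qed.

Variables (T : 'I_d -> {linear H -> H}) (al : R) (N : nat).
Hypothesis cT : forall i j x, T i (T j x) = T j (T i x).
Hypothesis T1 : forall j x, nr (T j x) <= nr x.
Hypotheses (al0 : 0 <= al) (N0 : (0 < N)%N).
Variable x : H.

Let orbit_at (a : idx) : H := ((al%:C)%C ^+ tdeg a : C) *: op_monomial T a x.

Lemma orbit_at_incr j a : orbit_at (incr j a) = ((al%:C)%C : C) *: T j (orbit_at a).
Proof.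
by rewrite /orbit_at tdeg_incr op_monomial_incr // linearZ /= exprS scalerA.
Qed.

Section Matrices.
Variables (n : nat) (ent : 'I_n.+1 -> {ffun 'I_d -> 'I_N}).
Hypothesis ent_bij : bijective ent.

Let midx s : idx := box_index (ent s).

(** The monomial with exponent a, seen as a coordinate vector when all exponents
    are less than N and as 0 otherwise; this convention makes the multiplication by
    a variable nilpotent and [shift_basis] true without side condition. *)
Let basis (a : idx) : 'rV[R[i]]_n.+1 := \row_t (midx t == a)%:R.

(** Multiplication by the j-th variable. *)
Let A (j : 'I_d) : 'M[R[i]]_n.+1 := \matrix_(s, t) (midx t == incr j (midx s))%:R.

Lemma midx_inj : injective midx.
Proof. by move=> s t /box_index_inj; apply: bij_inj. Qed.

Lemma midx_box a : a \in box d N -> exists s, midx s = a.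
Proof.
rewrite in_box => /forallP h; have [g _ gK] := ent_bij.
exists (g [ffun j => Ordinal (h j)]); rewrite /midx gK.
by apply/ffunP => j; rewrite !ffunE.
Qed.

Lemma basis_outside_box a : a \notin box d N -> basis a = 0.
Proof.
move=> ab; apply/rowP => t; rewrite !mxE; case: eqP => // ta.
by move: ab; rewrite -ta in_box => /forallP[] j; rewrite ffunE ltn_ord.
Qed.

Lemma basis_delta s : basis (midx s) = delta_mx 0 s.
Proof. by apply/rowP => t; rewrite !mxE eqxx /= (inj_eq midx_inj). Qed.

Lemma shift_basis a j : basis a *m A j = basis (incr j a).
Proof.
case: (boolP (a \in box d N)) => [/midx_box[s <-]|ab].
  by rewrite basis_delta -rowE; apply/rowP => t; rewrite !mxE.
rewrite (basis_outside_box ab) mul0mx basis_outside_box //; apply: contra ab.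
rewrite !in_box => /forallP h; apply/forallP => i; have := h i.
by rewrite ffunE; apply: leq_ltn_trans; rewrite leq_addr.
Qed.

Lemma mx_eq_on_basis (M M' : 'M[R[i]]_n.+1) :
  (forall a, basis a *m M = basis a *m M') -> M = M'.
Proof.
by move=> h; apply/row_matrixP => s; rewrite !rowE -basis_delta h.
Qed.

Lemma shift_comm i j : A i * A j = A j * A i.
Proof.
apply: mx_eq_on_basis => a; rewrite -!mulmxE !mulmxA !shift_basis.
by congr basis; apply/ffunP => k; rewrite !ffunE addnAC.
Qed.

Lemma shift_basis_iter a j k :
  basis a *m A j ^+ k = basis [ffun i => (a i + k * (i == j))%N].
Proof.
elim: k => [|k IHk].
  by rewrite expr0 mulmx1; congr basis; apply/ffunP => i; rewrite ffunE addn0.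
rewrite exprSr -mulmxE mulmxA IHk shift_basis; congr basis.
by apply/ffunP => i; rewrite !ffunE -addnA mulSn [(_ + k * _)%N]addnC.
Qed.

Lemma shift_nilpotent j : A j ^+ N = 0.
Proof.
apply: mx_eq_on_basis => a; rewrite mulmx0 shift_basis_iter basis_outside_box //.
rewrite in_box; apply/negP => /forallP/(_ j).
by rewrite ffunE eqxx muln1 ltnNge leq_addl.
Qed.

Lemma monomial_basis (a : 'I_d -> nat) :
  basis [ffun=> 0%N] *m (\prod_j A j ^+ a j) = basis [ffun j => a j].
Proof.
have gen r b : basis b *m (\prod_(j <- r) A j ^+ a j)
    = basis [ffun i => (b i + \sum_(j <- r) a j * (i == j))%N].
  elim: r b => [|j r IHr] b.
    by rewrite big_nil mulmx1; congr basis; apply/ffunP => i; rewrite ffunE big_nil addn0.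
  rewrite big_cons -mulmxE mulmxA shift_basis_iter IHr; congr basis.
  by apply/ffunP => i; rewrite !ffunE big_cons addnA.
rewrite gen; congr basis; apply/ffunP => i; rewrite !ffunE add0n.
rewrite (bigD1 i) //= eqxx muln1 big1 ?addn0 // => j ji.
by rewrite eq_sym (negPf ji) muln0.
Qed.

(** The polynomial with coordinates v, truncated at total degree k, evaluated at
    al T and applied to x.  Truncation by degree rather than by exponents is what
    makes [trunc_eval_shift] exact. *)
Let trunc_eval k (v : 'rV[R[i]]_n.+1) : H :=
  \sum_s (v 0 s : C) *: (if (tdeg (midx s) <= k)%N then orbit_at (midx s) else 0).

Lemma trunc_evalD k v w : trunc_eval k (v + w) = trunc_eval k v + trunc_eval k w.
Proof.
by rewrite /trunc_eval -big_split; apply: eq_bigr => s _; rewrite mxE scalerDl. Qed.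

Lemma trunc_evalZ k (z : C) v : trunc_eval k ((z : R[i]) *: v) = z *: trunc_eval k v.
Proof.
by rewrite /trunc_eval scaler_sumr; apply: eq_bigr => s _; rewrite mxE scalerA. Qed.

Lemma trunc_eval_sum k (I : Type) (r : seq I) (F : I -> 'rV[R[i]]_n.+1) :
  trunc_eval k (\sum_(i <- r) F i) = \sum_(i <- r) trunc_eval k (F i).
Proof.
elim: r => [|i r IHr]; last by rewrite !big_cons trunc_evalD IHr.
by rewrite !big_nil /trunc_eval big1 // => s _; rewrite mxE scale0r.
Qed.

Lemma trunc_eval_basis k a : (k < N)%N ->
  trunc_eval k (basis a) = if (tdeg a <= k)%N then orbit_at a else 0.
Proof.
move=> kN; case: (boolP (a \in box d N)) => [/midx_box[s <-]|ab].
  rewrite /trunc_eval (bigD1 s) //= mxE eqxx scale1r big1 ?addr0 // => t ts.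
  by rewrite mxE (inj_eq midx_inj) (negPf ts) scale0r.
rewrite basis_outside_box //; case: ifP => ak.
  move: ab; rewrite in_box => /forallP[] j.
  by apply: leq_ltn_trans (leq_tdeg _ _) _; apply: leq_ltn_trans ak kN.
by rewrite /trunc_eval big1 // => s _; rewrite mxE scale0r.
Qed.

Lemma trunc_eval_shift k j v : (k < N)%N ->
  trunc_eval k (v *m A j)
  = if k is k'.+1 then ((al%:C)%C : C) *: T j (trunc_eval k' v) else 0.
Proof.
move=> kN; have -> : v *m A j = \sum_s v 0 s *: basis (incr j (midx s)).
  rewrite mulmx_sum_row; apply: eq_bigr => s _; congr (_ *: _).
  by rewrite rowE -basis_delta shift_basis.
rewrite trunc_eval_sum; under eq_bigr do rewrite trunc_evalZ trunc_eval_basis // tdeg_incr.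
case: k kN => [|k] kN; first by rewrite big1 // => s _; rewrite scaler0.
rewrite linear_sum scaler_sumr; apply: eq_bigr => s _.
rewrite linearZ /= scalerA [_ * (v 0 s : C)]mulrC -scalerA ltnS; congr (_ *: _).
by case: ifP => _; rewrite ?orbit_at_incr // linear0 scaler0.
Qed.

Let G : 'M[R[i]]_n.+1 := \matrix_(s, t) \sum_(k < N)
  ip (if (tdeg (midx s) <= k)%N then orbit_at (midx s) else 0)
     (if (tdeg (midx t) <= k)%N then orbit_at (midx t) else 0).

Lemma gramE v : qf G v = ((\sum_(k < N) nr (trunc_eval k v) ^+ 2)%:C)%C.
Proof.
rewrite rmorph_sum /=.
transitivity (\sum_(k < N) ip (trunc_eval k v) (trunc_eval k v)); last first.
  by apply: eq_bigr => k _; rewrite Hip nrE -rmorphXn.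
under [RHS]eq_bigr do rewrite /trunc_eval ip_sum.
rewrite /qf mxE.
transitivity (\sum_t \sum_s \sum_(k < N) (v 0 s * (v 0 t)^* *
  ip (if (tdeg (midx s) <= k)%N then orbit_at (midx s) else 0)
     (if (tdeg (midx t) <= k)%N then orbit_at (midx t) else 0)) : R[i]).
  apply: eq_bigr => t _; rewrite !mxE mulr_suml; apply: eq_bigr => s _.
  rewrite !mxE mulrAC; exact: mulr_sumr.
rewrite exchange_big [RHS]exchange_big; apply: eq_bigr => s _ /=.
by rewrite exchange_big.
Qed.

Lemma gram_herm : G^t* = G.
Proof.
apply/matrixP => s t; rewrite !mxE rmorph_sum; apply: eq_bigr => k _ /=.
by rewrite [RHS]hermC /= expr0 mul1r.
Qed.

(** Applied to the constant polynomial 1, the matrix inequality compares the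
    squared seminorm of p, truncated to exponents less than N, with that of 1, which
    is N times the squared norm of x.  A shift lowers the truncation degree by one and
    multiplies by al T_j, so its norm is at most al. *)
Lemma krylov_bound_mx (p : idx -> C) K (kap : R) : (N <= K)%N -> (2 <= d)%N ->
  d.-1%:R * al ^+ 2 <= 1 ->
  (forall s : 'I_d -> C, (forall j, nr (s j) = 1) ->
     nr (\sum_(a <- box d K) p a * monomial s a) ^+ 2 <= kap) ->
  \sum_(k < N) nr (\sum_(a <- deg_ball d k.+1) p a *: orbit_at a) ^+ 2
  <= kap * (N%:R * nr x ^+ 2).
Proof.
move=> NK d2 dal hp.
pose c (a : {ffun 'I_d -> 'I_K}) : R[i] := p (box_index a).
have hc (s : 'I_d -> R[i]) : (forall j, `|s j| = 1) ->
    `|mpeval idfun c s| ^+ 2 <= ((kap%:C)%C : R[i]).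
  move=> s1; have s1' j : nr (s j : C) = 1 by rewrite /nr (s1 j).
  have := hp s s1'; rewrite big_box.
  have -> : \sum_(a : {ffun 'I_d -> 'I_K}) p (box_index a) * monomial s (box_index a)
    = mpeval idfun c s.
    rewrite /mpeval; apply: eq_bigr => a _; congr (_ * _).
    by apply: eq_bigr => j _; rewrite ffunE.
  by rewrite -lecR rmorphXn /= -nrE.
have al20 : (0 : R[i]) <= ((al ^+ 2)%:C)%C by rewrite lecR sqr_ge0.
have dal' : (d.-1)%:R * (((al ^+ 2)%:C)%C : R[i]) <= 1.
  by rewrite -(rmorph_nat (real_complex R)) -rmorphM -[X in _ <= X]/((1%:C)%C) lecR.
have Gpsd : psd G.
  by move=> v; rewrite gramE lecR sumr_ge0 // => k _; apply: sqr_ge0.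
have GA j v : qf G (v *m A j) <= ((al ^+ 2)%:C)%C * qf G v.
  rewrite !gramE -rmorphM lecR.
  case: N N0 (fun k => trunc_eval_shift (k := k) j v) => // N' _ es.
  rewrite big_ord_recl es // nr0 expr0n add0r.
  rewrite [X in _ <= _ * X]big_ord_recr /= mulrDr.
  rewrite -[leLHS]addr0; apply: lerD; last by rewrite mulr_ge0 ?sqr_ge0.
  rewrite mulr_sumr; apply: ler_sum => k _; rewrite es /=; last by rewrite ltnS.
  rewrite nrZ nr_real // exprMn ler_wpM2l ?sqr_ge0 //.
  by rewrite lerXn2r ?nnegrE ?nr_ge0.
have := matrix_von_neumann d2 N0 hc gram_herm Gpsd al20 dal' GA shift_comm shift_nilpotent.
move=> /(_ (basis [ffun=> 0%N])).
have -> : basis [ffun=> 0%N] *m mpeval (fun y => y%:M) c A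
   = \sum_(a <- box d K) (p a : R[i]) *: basis a.
  rewrite big_box /mpeval mulmx_sumr; apply: eq_bigr => a _.
  rewrite -mulmxE mulmxA -scalemx1 -scalemxAr mulmx1 -scalemxAl monomial_basis.
  by congr (_ *: basis _); apply/ffunP => j; rewrite !ffunE.
rewrite !gramE -rmorphM lecR.
have -> : \sum_(k < N) nr (trunc_eval k (basis [ffun=> 0%N])) ^+ 2 = N%:R * nr x ^+ 2.
  rewrite (eq_bigr (fun=> nr x ^+ 2)) ?sumr_const ?card_ord ?mulr_natl // => k _.
  have t0 : tdeg ([ffun=> 0%N] : idx) = 0%N by rewrite /tdeg big1 // => j _; rewrite ffunE.
  by rewrite trunc_eval_basis ?ltn_ord // t0 /= /orbit_at t0 expr0 scale1r op_monomial0.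
apply: le_trans; rewrite le_eqVlt; apply/orP; left; apply/eqP.
apply: eq_bigr => k _; congr (nr _ ^+ 2).
rewrite trunc_eval_sum; under [RHS]eq_bigr do rewrite trunc_evalZ trunc_eval_basis ?ltn_ord //.
have sub : (deg_ball d k.+1 `<=` box d K)%fset.
  apply/fsubsetP => a; rewrite in_deg_ball in_box => ak; apply/forallP => j.
  apply: leq_ltn_trans (leq_tdeg a j) _; apply: leq_trans ak _.
  exact: leq_trans (ltn_ord k) NK.
rewrite (sum_deg_split _ sub) [X in _ = _ + X]big1 ?addr0 => [|a ka].
  rewrite big_seq [RHS]big_seq; apply: eq_bigr => a.
  by rewrite in_deg_ball ltnS => ->.
by rewrite leqNgt ka scaler0.
Qed.

End Matrices.

Lemma krylov_bound (p : idx -> C) K (kap : R) : (N <= K)%N -> (2 <= d)%N ->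
  d.-1%:R * al ^+ 2 <= 1 ->
  (forall s : 'I_d -> C, (forall j, nr (s j) = 1) ->
     nr (\sum_(a <- box d K) p a * monomial s a) ^+ 2 <= kap) ->
  \sum_(k < N) nr (\sum_(a <- deg_ball d k.+1) p a *: orbit_at a) ^+ 2
  <= kap * (N%:R * nr x ^+ 2).
Proof.
have cardI : #|{ffun 'I_d -> 'I_N}| = (#|{ffun 'I_d -> 'I_N}|.-1).+1.
  by rewrite prednK // card_ffun !card_ord expn_gt0 N0.
pose ent (s : 'I_(#|{ffun 'I_d -> 'I_N}|.-1).+1) : {ffun 'I_d -> 'I_N} :=
  enum_val (cast_ord (esym cardI) s).
have eb : bijective ent.
  exists (fun a => cast_ord cardI (enum_rank a)) => s.
    by rewrite /ent enum_valK cast_ordKV.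
  by rewrite /ent cast_ordK enum_rankK.
exact: krylov_bound_mx eb p K kap.
Qed.

End Hilbert.
End Krylov.

(** * Power series in commuting contractions *)

Section Assembly.
Variables (R : realType) (d : nat).
Local Notation C := (Cplx R).
Local Notation idx := (multi_index d).

Lemma partial_sumE (I : choiceType) (V : zmodType) (u : I -> V) (A : {fset I}) :
  partial_sum u A = \sum_(i <- A) u i.
Proof. by rewrite /partial_sum big_seq_fsetE. Qed.

(** The splitting consumed by [sum_deg_geom_tail]; x = (1 + r) / 2 is halfway
    between r and 1. *)
Lemma ratio_split (r : R) : 0 < r -> r < 1 ->
  exists x y : R, [/\ 0 <= x < 1, 0 <= y < 1 & r = y * x].
Proof.
move=> r0 r1; pose x := (1 + r) / 2; have x0 : 0 < x by rewrite /x; lra.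
have x1 : x < 1 by rewrite /x; lra.
exists x, (r / x); rewrite (ltW x0) x1 divfK ?gt_eqF //; split=> //.
apply/andP; split; first by rewrite divr_ge0 // ltW.
by rewrite ltr_pdivrMr // mul1r /x; lra.
Qed.

(** On the torus of radius rho the truncation of the series to a box differs from f
    by a geometric tail: a multi-index outside the box of size K has degree at
    least K. *)
Lemma truncation_sup_bound (f : ('I_d -> C) -> C) (c : idx -> C) (rho : R) :
  (forall z, polydisk z -> nr (f z) <= 1) -> (forall a, nr (c a) <= 1) ->
  (forall z, polydisk z -> has_power_series_at f (fun=> 0) c z) ->
  0 < rho < 1 -> exists y B : R, [/\ 0 <= y < 1, 0 <= B &
   forall K (s : 'I_d -> C), (forall j, nr (s j) = 1) ->
   nr (\sum_(a <- box d K) (c a * (rho%:C)%C ^+ tdeg a) * monomial s a)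
   <= 1 + B * y ^+ K].
Proof.
move=> f1 c1 fc /andP[r0 r1].
have [x [y [x01 y01 yx]]] := ratio_split r0 r1.
have /andP[y0 y1] := y01; have /andP[x0 x1] := x01.
have ix : 0 < (1 - x)^-1 by rewrite invr_gt0 subr_gt0.
exists y, ((1 - x)^-1 ^+ d); split; rewrite ?y0 ?exprn_ge0 ?(ltW ix) // => K s s1.
have nrho : nr ((rho%:C)%C : C) = rho by rewrite nr_real // ltW.
pose z j : C := (rho%:C)%C * s j.
have zD : polydisk z by move=> j; rewrite norm_lt_nr ?ltr01 // nrM nrho s1 mulr1.
have zr j : nr (z j) <= rho by rewrite nrM nrho s1 mulr1.
have -> : \sum_(a <- box d K) (c a * (rho%:C)%C ^+ tdeg a) * monomial s a
    = \sum_(a <- box d K) c a * monomial z a.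
  by apply: eq_bigr => a _; rewrite -mulrA -monomialZ.
set S := \sum_(a <- _) _.
suff h : nr (f z - S) <= (1 - x)^-1 ^+ d * y ^+ K.
  have := nrD (f z) (S - f z); rewrite addrC subrK [nr (S - _)]nrB.
  by have := f1 z zD; lra.
apply: (has_sum_le (B := box d K) (fc z zD)) => A KA.
rewrite (_ : (fun j => z j - 0) = z); last by apply/funext => j; rewrite subr0.
rewrite (sum_fset_split _ KA) addrC addKr.
apply: le_trans (nr_sum _ _ _) _; rewrite mulrC.
have y01' : 0 <= y <= 1 by rewrite y0 ltW.
apply: le_trans (sum_deg_geom_tail A K x01 y01').
rewrite [leLHS]big_mkcond [leRHS]big_mkcond; apply: ler_sum => a _ /=.
case: ifPn => aK; last by case: ifP => // _; rewrite exprn_ge0 // mulr_ge0.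
have -> : (K <= tdeg a)%N.
  move: aK; rewrite in_box negb_forall => /existsP[j]; rewrite -leqNgt => Kj.
  exact: leq_trans Kj (leq_tdeg a j).
rewrite nrM -[leRHS]mul1r -yx ler_pM ?nr_ge0 ?c1 //.
exact: nr_monomial_le.
Qed.

Section Operators.
Variables (H : completeNormedModType C) (T : 'I_d -> {linear H -> H}).
Hypothesis T1 : forall j x, nr (T j x) <= nr x.

Lemma op_monomial_lin (a : idx) (u : C) x y :
  op_monomial T a (u *: x + y) = u *: op_monomial T a x + op_monomial T a y.
Proof.
rewrite /op_monomial; elim: (index_enum _) => [|j r IHr]; first by rewrite !big_nil.
rewrite !big_cons /= IHr; elim: (a j) => //= k ->.
by rewrite linearP.
Qed.

Lemma nr_op_monomial (a : idx) x : nr (op_monomial T a x) <= nr x.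
Proof.
rewrite /op_monomial; elim: (index_enum _) => [|j r IHr]; first by rewrite !big_nil.
rewrite !big_cons /=; apply: le_trans IHr; elim: (a j) => //= k.
exact: le_trans.
Qed.

Variables (b : idx -> C) (r : R).
Hypothesis br : forall a, nr (b a) <= r ^+ tdeg a.

Variables x_ y_ : R.
Hypotheses (x01 : 0 <= x_ < 1) (y01 : 0 <= y_ < 1) (ryx : r = y_ * x_).
Local Notation B := ((1 - x_)^-1 ^+ d).

Lemma geom_const_ge0 : 0 <= B.
Proof. by have /andP[_ x1] := x01; rewrite exprn_ge0 // invr_ge0 subr_ge0 ltW. Qed.

Definition op_psum (A : {fset idx}) x : H := \sum_(a <- A) b a *: op_monomial T a x.

Lemma op_psum_tail A n x : (deg_ball d n `<=` A)%fset ->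
  nr (op_psum A x - op_psum (deg_ball d n) x) <= B * y_ ^+ n * nr x.
Proof.
have /andP[y0 y1] := y01; have B0 := geom_const_ge0.
move=> nA; rewrite /op_psum (sum_deg_split _ nA) addrC addKr.
apply: le_trans (nr_sum _ _ _) _; rewrite [B * _]mulrC.
have y01' : 0 <= y_ <= 1 by rewrite y0 ltW.
apply: le_trans (ler_wpM2r (nr_ge0 x) (sum_deg_geom_tail A n x01 y01')).
rewrite mulr_suml; apply: ler_sum => a _; rewrite nrZ -ryx ler_pM ?nr_ge0 //.
exact: nr_op_monomial.
Qed.

Lemma op_psum_lin A (u : C) x y :
  op_psum A (u *: x + y) = u *: op_psum A x + op_psum A y.
Proof.
rewrite /op_psum scaler_sumr -big_split; apply: eq_bigr => a _ /=.
by rewrite op_monomial_lin scalerDr !scalerA [b a * u]mulrC.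
Qed.

Lemma deg_ball_sub n m : (n <= m)%N -> (deg_ball d n `<=` deg_ball d m)%fset.
Proof.
by move=> nm; apply/fsubsetP => a; rewrite !in_deg_ball => /leq_trans; apply.
Qed.

Lemma op_psum_cvg x : exists s : H, forall n,
  nr (s - op_psum (deg_ball d n) x) <= B * y_ ^+ n * nr x.
Proof.
have /andP[y0 y1] := y01; have B0 := geom_const_ge0.
pose u n := op_psum (deg_ball d n) x.
have hu n m : (n <= m)%N -> nr (u m - u n) <= B * y_ ^+ n * nr x.
  by move=> nm; apply: op_psum_tail; apply: deg_ball_sub.
have : cvg (u @ \oo).
  apply/cauchy_cvgP/cauchy_exP => e e0.
  have e0' : 0 < complex.Re e by rewrite -ltcR RRe_real ?gtr0_real.
  have [n hn] := @geometric_small R y_ (B * nr x) _ y01 e0'.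
  exists (u n); exists n => // m /= nm.
  rewrite -ball_normE /= norm_lt_nr // nrB; apply: le_lt_trans (hu _ _ nm) _.
  by rewrite mulrAC.
move=> /cvg_ex[s us]; exists s => n.
apply/ler_addgt0Pr => e e0.
have e0' : (0 : C) < (e%:C)%C by rewrite ltcR.
move/cvgrPdist_lt : us => /(_ _ e0')[m0 _ hm0].
have := hm0 (maxn m0 n) (leq_maxl _ _); rewrite /= norm_lt_nr //= => h1.
have := hu n (maxn m0 n) (leq_maxr _ _) => h2.
have := nr_tri (u (maxn m0 n)) s (u n); rewrite /u in h1 h2 *; lra.
Qed.

(** Linearity passes to the limit through the uniform estimate on the partial
    sums. *)
Lemma op_series : exists S : {linear H -> H}, forall x n,
  nr (S x - op_psum (deg_ball d n) x) <= B * y_ ^+ n * nr x.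
Proof.
have /andP[y0 y1] := y01; have B0 := geom_const_ge0.
have [S0 hS0] := choice op_psum_cvg.
have lin : linear S0.
  move=> u x y; apply/eqP; rewrite -subr_eq0; apply/eqP/nr_eq0.
  apply/eqP; rewrite eq_le nr_ge0 andbT; apply/ler_addgt0Pr => e e0.
  rewrite add0r.
  pose K := B * (nr (u *: x + y) + nr u * nr x + nr y).
  have [n hn] := @geometric_small R y_ K _ y01 e0.
  apply: le_trans (ltW hn).
  have h1 := hS0 (u *: x + y) n; have h2 := hS0 x n; have h3 := hS0 y n.
  rewrite op_psum_lin in h1.
  set p := op_psum _ x in h1 h2; set q := op_psum _ y in h1 h3.
  have -> : S0 (u *: x + y) - (u *: S0 x + S0 y)
    = (S0 (u *: x + y) - (u *: p + q)) - (u *: (S0 x - p) + (S0 y - q)).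
    by rewrite scalerBr addrACA -opprD opprB addrA subrK.
  apply: le_trans (nrD _ _) _; rewrite nrN.
  have h4 := nrD (u *: (S0 x - p)) (S0 y - q); rewrite nrZ in h4.
  have h5 : nr u * nr (S0 x - p) <= nr u * (B * y_ ^+ n * nr x).
    by rewrite ler_wpM2l ?nr_ge0.
  rewrite /K; lra.
pose L := GRing.isLinear.Build C H H *:%R S0 lin.
by exists (HB.pack S0 L : {linear H -> H}).
Qed.

Lemma opnorm_le (U : H -> H) (K : R) :
  (forall x, nr x <= 1 -> nr (U x) <= K) -> (opnorm U <= K%:E)%E.
Proof.
move=> h; apply: ub_ereal_sup => _ [x /= x1 <-]; rewrite lee_fin; apply: h.
by move: x1; rewrite nrE -[X in _ <= X -> _]/((1%:C)%C) lecR.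
Qed.

Lemma opnorm_ge0 (U : H -> H) : (0 <= opnorm U)%E.
Proof.
apply: (@le_trans _ _ (nr (U 0))%:E); first by rewrite lee_fin nr_ge0.
by apply: ereal_sup_ubound; exists 0; rewrite //= normr0 ler01.
Qed.

(** The neighbourhoods of 0 in the extended reals are tested on real values: the
    norms at stake are finite once they are bounded. *)
Lemma op_power_series (S : {linear H -> H}) :
  (forall x n, nr (S x - op_psum (deg_ball d n) x) <= B * y_ ^+ n * nr x) ->
  is_op_power_series b T S.
Proof.
have /andP[y0 y1] := y01; have B0 := geom_const_ge0.
move=> hS P hP0; have : nbhs (0 : R) (fun v => P v%:E) by exact: hP0.
move=> /nbhs_ballP[e /= e0 hP].
have e20 : 0 < e / 2 by rewrite divr_gt0.
have [n hn] := @geometric_small R y_ (2 * B) _ y01 e20.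
exists (deg_ball d n) => // A /= nA.
set V := fun x => _.
have hV : (opnorm V <= (e / 2)%:E)%E.
  apply: opnorm_le => x x1; rewrite /V.
  have -> : partial_sum (fun a => b a *: op_monomial T a x) A = op_psum A x.
    exact: partial_sumE.
  apply: le_trans (nr_tri (op_psum (deg_ball d n) x) _ _) _.
  have h1 := op_psum_tail x nA; have h2 := hS x n; rewrite [nr (_ - S x)]nrB.
  have : B * y_ ^+ n * nr x <= B * y_ ^+ n.
    by rewrite ler_piMr // mulr_ge0 // exprn_ge0.
  lra.
have V0 := opnorm_ge0 V.
case E : (opnorm V) hV V0 => [v| |] //; rewrite !lee_fin => v1 v0.
by apply: hP; rewrite /= /ball /= sub0r normrN ger0_norm //; lra.
Qed.

End Operators.
End Assembly.

(** * The Schur-Agler radius *)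

Section Radius.
Variables (R : realType) (d : nat).
Local Notation C := (Cplx R).
Local Notation idx := (multi_index d).

(** The polynomials to which the matrix inequality is applied are truncations of
    the dilate of f by rho to boxes of size K >= N.  Only the coefficients with
    exponents less than N matter for the left-hand side, while the supremum on the
    torus tends to at most 1 as K grows. *)
Lemma cesaro_bound (f : ('I_d -> C) -> C) (c : idx -> C) (rho al : R)
    (H : completeNormedModType C) (ip : {dot H for (@Num.conj R[i])})
    (T : 'I_d -> {linear H -> H}) N x :
  (2 <= d)%N -> (forall z, polydisk z -> nr (f z) <= 1) ->
  (forall a, nr (c a) <= 1) ->
  (forall z, polydisk z -> has_power_series_at f (fun=> 0) c z) ->
  0 < rho -> rho < 1 -> 0 <= al -> d.-1%:R * al ^+ 2 <= 1 -> is_hilbert ip ->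
  (forall i j x, T i (T j x) = T j (T i x)) ->
  (forall j x, nr (T j x) <= nr x) -> (0 < N)%N ->
  \sum_(k < N) nr (op_psum T (fun a => c a * ((rho * al)%:C)%C ^+ tdeg a)
     (deg_ball d k.+1) x) ^+ 2 <= N%:R * nr x ^+ 2.
Proof.
move=> d2 f1 c1 fc r0 r1 al0 dal Hip cT T1 N0.
have rho01 : 0 < rho < 1 by rewrite r0.
have [y [B [y01 B0 hB]]] := truncation_sup_bound f1 c1 fc rho01; have /andP[y0 y1] := y01.
set X := N%:R * _; have X0 : 0 <= X by rewrite mulr_ge0 ?sqr_ge0.
pose p a : C := c a * (rho%:C)%C ^+ tdeg a.
have bnd K : (N <= K)%N -> \sum_(k < N) nr (op_psum T
     (fun a => c a * ((rho * al)%:C)%C ^+ tdeg a) (deg_ball d k.+1) x) ^+ 2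
   <= (1 + B * y ^+ K) ^+ 2 * X.
  move=> NK.
  have hp (s : 'I_d -> C) : (forall j, nr (s j) = 1) ->
      nr (\sum_(a <- box d K) p a * monomial s a) ^+ 2 <= (1 + B * y ^+ K) ^+ 2.
    move=> s1; rewrite lerXn2r ?nnegrE ?nr_ge0 ?hB //.
    by rewrite addr_ge0 // mulr_ge0 // exprn_ge0.
  have := krylov_bound Hip cT T1 al0 N0 x NK d2 dal hp.
  apply: le_trans; rewrite le_eqVlt; apply/orP; left; apply/eqP.
  apply: eq_bigr => k _; congr (nr _ ^+ 2); apply: eq_bigr => a _.
  by rewrite scalerA /p -mulrA -exprMn -rmorphM.
apply/ler_addgt0Pr => e e0.
(* For t <= 1 one has (1 + t)^2 <= 1 + 3 t, so t (3 X + 1) < e is enough. *)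
have D0 : 0 < 3 * X + 1 by lra.
have e1 : 0 < Num.min 1 (e / (3 * X + 1)) by rewrite lt_min ltr01 divr_gt0.
have [K0 hK0] := @geometric_small R y B _ y01 e1.
pose K := maxn K0 N; have := bnd K (leq_maxr _ _).
have yK : y ^+ K <= y ^+ K0 by rewrite ler_wiXn2l ?(ltW y1) // leq_maxl.
have hK : B * y ^+ K < Num.min 1 (e / (3 * X + 1)).
  by apply: le_lt_trans hK0; rewrite ler_wpM2l.
have t0 : 0 <= B * y ^+ K by rewrite mulr_ge0 // exprn_ge0.
move: hK t0; set t := B * y ^+ K; rewrite lt_min => /andP[t1 te] t0.
rewrite ltr_pdivlMr // in te.
move=> /le_trans; apply.
have : t * X * t <= t * X * 1.
  apply: ler_wpM2l (ltW t1); exact: mulr_ge0.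
nra.
Qed.

Lemma opnorm_contraction (H : normedModType C) (T : {linear H -> H}) :
  (opnorm T < 1)%E -> forall x, nr (T x) <= nr x.
Proof.
move=> T1 x; have [->|x0] := eqVneq x 0; first by rewrite linear0.
have nx : 0 < nr x.
  by rewrite lt_def nr_ge0 andbT; apply: contra x0 => /eqP/nr_eq0 ->.
pose y := (((nr x)^-1%:C)%C : C) *: x.
have nv : nr ((((nr x)^-1)%:C)%C : C) = (nr x)^-1 by rewrite nr_real // invr_ge0 ltW.
have ny : nr y = 1 by rewrite nrZ nv mulVf // gt_eqF.
have : ((nr (T y))%:E < 1)%E.
  apply: le_lt_trans T1; apply: ereal_sup_ubound; exists y => //=.
  by rewrite nrE ny.
rewrite lte_fin linearZ /= nrZ nv mulrC ltr_pdivrMr // mul1r.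
exact: ltW.
Qed.

(** If the limit l exceeded X, the terms would eventually be at least X + e with
    e = (l - X) / 2, and so would their means, up to a vanishing fraction. *)
Lemma cesaro_limit (u : nat -> R) (l X : R) : 0 <= X ->
  (forall k, 0 <= u k) ->
  (forall e, 0 < e -> exists n, forall k, (n <= k)%N -> l - e <= u k) ->
  (forall N, (0 < N)%N -> \sum_(k < N) u k <= N%:R * X) -> l <= X.
Proof.
move=> X0 u0 hu hN; rewrite leNgt; apply/negP => Xl.
pose e := (l - X) / 2; have e0 : 0 < e by rewrite /e; lra.
have [n hn] := hu e e0.
pose N0 := Num.bound (n%:R * (X + e) / e).
have q0 : 0 <= n%:R * (X + e) / e.
  by rewrite divr_ge0 ?(ltW e0) // mulr_ge0 // addr_ge0 // ltW.
have := archi_boundP q0; rewrite -/N0 ltr_pdivrMr // => hb.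
have := hN (n + N0.+1)%N (ltn_addl _ _) => /(_ isT).
rewrite big_split_ord /= natrD => h.
have s1 : 0 <= \sum_(i < n) u i by apply: sumr_ge0.
have s2 : N0.+1%:R * (X + e) <= \sum_(i < N0.+1) u (n + i)%N.
  have -> : N0.+1%:R * (X + e) = \sum_(i < N0.+1) (X + e).
    by rewrite sumr_const card_ord mulr_natl.
  apply: ler_sum => i _; apply: le_trans (hn _ (leq_addr _ _)).
  by rewrite /e; lra.
rewrite -natr1 in h s2.
have : 0 <= n%:R * e by rewrite mulr_ge0 // ltW.
nra.
Qed.

(** With r = rho * al, the r-dilate of f at T is the rho-dilate of f at al T, and
    rho < 1 leaves room for truncating the series uniformly on the torus. *)
Lemma dilate_agler (f : ('I_d -> C) -> C) (r al : R) :
  (2 <= d)%N -> d.-1%:R * al ^+ 2 <= 1 -> 0 < r -> r < al -> r < 1 ->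
  schur_class f -> agler_class (dilate r f).
Proof.
move=> d2 dal r0 ra r1 fS; have [f_an f1'] := fS.
have f1 z : polydisk z -> nr (f z) <= 1 by apply: nr_f.
have nr_r : nr ((r%:C)%C : C) = r by rewrite nr_real // ltW.
have rD (z : 'I_d -> C) : polydisk z -> polydisk (fun j => (r%:C)%C * z j).
  move=> zD j; have := zD j; rewrite !norm_lt_nr ?ltr01 // nrM nr_r => z1.
  by apply: le_lt_trans z1; rewrite ler_piMl ?nr_ge0 // ltW.
split.
  split=> [w wD|z zD]; last by apply: f1'; apply: rD.
  have [e [c [e0 h]]] := f_an _ (rD w wD).
  exists e, (fun a => c a * (r%:C)%C ^+ tdeg a); split=> // z zw.
  have := h (fun j => (r%:C)%C * z j).
  rewrite /has_power_series_at /dilate.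
  rewrite (_ : (fun a => c a * monomial _ a) = fun a =>
     c a * (r%:C)%C ^+ tdeg a * monomial (fun j => z j - w j) a).
    apply=> j; have := zw j; rewrite -mulrBr !norm_lt_nr // nrM nr_r => zwj.
    by apply: le_lt_trans zwj; rewrite ler_piMl ?nr_ge0 // ltW.
  apply/funext => a; rewrite -mulrA -monomialZ; congr (_ * monomial _ _).
  by apply/funext => j; rewrite mulrBr.
have [c [c1 fc]] := schur_expansion fS.
pose b a : C := c a * (r%:C)%C ^+ tdeg a.
exists b; split=> [z zD|H ip Hip T [cT Tn]].
  have := fc _ (rD z zD); rewrite /has_power_series_at /dilate.
  rewrite (_ : (fun a => c a * monomial _ a) = fun a =>
     b a * monomial (fun j => z j - 0) a) //.
  apply/funext => a; rewrite -mulrA -monomialZ; congr (_ * monomial _ _).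
  by apply/funext => j; rewrite !subr0.
have T1 j x : nr (T j x) <= nr x by apply: opnorm_contraction.
have br a : nr (b a) <= r ^+ tdeg a.
  by rewrite nrM nrX nr_r ler_piMl // exprn_ge0 // ltW.
have [x_ [y_ [x01 y01 ryx]]] := ratio_split r0 r1; have /andP[y0 y1] := y01.
have [S hS] := op_series T1 br x01 y01 ryx.
exists S; split; first exact: (op_power_series T1 br x01 y01 ryx hS).
apply: opnorm_le => x x1; apply: le_trans x1.
have al0 : 0 < al by apply: lt_trans ra.
pose rho := r / al; have rho0 : 0 < rho by rewrite divr_gt0.
have rho1 : rho < 1 by rewrite ltr_pdivrMr // mul1r.
have ces N : (0 < N)%N ->
    \sum_(k < N) nr (op_psum T b (deg_ball d k.+1) x) ^+ 2 <= N%:R * nr x ^+ 2.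
  have := @cesaro_bound f c rho al H ip T N x d2 f1 c1 fc rho0 rho1 (ltW al0)
    dal Hip cT T1.
  by rewrite /b /rho divfK // gt_eqF.
rewrite -(ler_pXn2r (ltn0Sn 1)) ?nnegrE ?nr_ge0 //.
apply: (@cesaro_limit (fun k => nr (op_psum T b (deg_ball d k.+1) x) ^+ 2)) => //.
- exact: sqr_ge0.
- by move=> k; apply: sqr_ge0.
move=> e e0; set L := nr (S x); have L0 : 0 <= L by apply: nr_ge0.
pose B := (1 - x_)^-1 ^+ d.
have B0 : 0 <= B by apply: geom_const_ge0.
(* With w the error at the k-th partial sum, (L - w)^2 >= L^2 - 2 L w. *)
have D0 : 0 < 2 * L + 1 by lra.
have [n hn] := @geometric_small R y_ (B * nr x) _ y01 (divr_gt0 e0 D0).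
exists n => k nk; have := hS x k.+1; rewrite -/B -/L.
set v := nr (op_psum _ _ _ _); set w := nr (_ - _) => hw.
have v0 : 0 <= v by apply: nr_ge0.
have Lv : L <= v + w.
  by have := nrD (S x - op_psum T b (deg_ball d k.+1) x) (op_psum T b (deg_ball d k.+1) x);
    rewrite subrK -/v -/w -/L addrC.
have w0 : 0 <= w by apply: nr_ge0.
have we : w * (2 * L + 1) < e.
  rewrite -ltr_pdivlMr //; apply: le_lt_trans hn; apply: le_trans hw _.
  rewrite mulrAC ler_wpM2l ?(mulr_ge0 B0 (nr_ge0 _)) //.
  by rewrite ler_wiXn2l ?(ltW y1) // leqW.
have [Lw|wL] := leP L w; first by nra.
have : (L - w) ^+ 2 <= v ^+ 2 by rewrite lerXn2r ?nnegrE; lra.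
nra.
Qed.

End Radius.

Theorem theorem1p3 (R : realType) (d : nat) (hd : (2 <= d)%N) :
  1 / Num.sqrt (d%:R - 1) <= schur_agler_radius R d.
Proof.
set al : R := 1 / _.
have dE : d%:R - 1 = d.-1%:R :> R by rewrite -{1}(ltn_predK hd) -natr1 addrK.
have d1 : 1 <= d.-1%:R :> R by rewrite ler1n -ltnS (ltn_predK hd).
have sq1 : 1 <= Num.sqrt (d.-1%:R : R) by rewrite -[leLHS]sqrtr1 ler_wsqrtr.
have sq0 : 0 < Num.sqrt (d.-1%:R : R) by apply: lt_le_trans sq1.
have al0 : 0 < al by rewrite /al dE divr_gt0.
have al1 : al <= 1 by rewrite /al dE ler_pdivrMr // mul1r.
have dal : d.-1%:R * al ^+ 2 <= 1.
  rewrite /al dE div1r exprVn sqr_sqrtr ?ler0n // divff // gt_eqF //.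
  exact: lt_le_trans d1.
rewrite /schur_agler_radius; set E := [set r | _].
have Eub : has_ubound E by exists 1 => r [/andP[_ /ltW]].
have Emem r : 0 < r -> r < al -> E r.
  move=> r0 ra; have r1 : r < 1 by apply: lt_le_trans ra _.
  split; first by rewrite r0.
  by move=> f fS; apply: (dilate_agler hd dal).
rewrite leNgt; apply/negP => lt.
pose r := (Num.max 0 (sup E) + al) / 2.
have m : Num.max 0 (sup E) < al by rewrite gt_max al0.
have m0 : 0 <= Num.max 0 (sup E) by rewrite le_max lexx.
have ms : sup E <= Num.max 0 (sup E) by rewrite le_max lexx orbT.
have Er : E r by apply: Emem; rewrite /r; lra.
have := ub_le_sup Eub Er; rewrite /r; lra.
Qed.
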